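(* Let $X$ be a simplicial set such that all its closed faces are contractible. Suppose there are cohomology classes $\xi_1,\ldots,\xi_n\in H^1(X;\mathbb{F}_2)$ whose (cup) product $\xi_1\cdots\xi_n\in H^n(X;\mathbb{F}_2)$ is non-zero. Then $X$ has at least $2^n$ faces of dimension $n$.
   Context: A face of dimension $k$ of a simplicial set $X$ is a non-degenerate $k$-simplex of $X$. The corresponding closed face is the image of the closed standard simplex $\Delta^k$ in the geometric realization $|X|$ under the characteristic map of that simplex; it is required to be contractible as a topological space (subspace of $|X|$). The vertices of a face may coincide in $X$, so a closed face need not be an embedded simplex. $H^*(X;\mathbb{F}_2)$ is the cohomology of (the geometric realization of) $X$ with coefficients in the field of two elements. *)

(* Defs.v *)
From HB Require Import structures.
From Stdlib Require Import Relation_Operators.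
From mathcomp Require Import all_boot all_order all_algebra generic_quotient.
From mathcomp Require Import all_classical all_reals all_analysis.
Set Implicit Arguments.
Unset Strict Implicit.
Unset Printing Implicit Defensive.
Import Order.TTheory GRing.Theory Num.Theory.
Import numFieldNormedType.Exports.
Local Open Scope classical_set_scope.
Local Open Scope ring_scope.
Local Open Scope quotient_scope.

Section StandardSimplex.
Variable R : realType.

Definition simplex_set (n : nat) : set 'rV[R]_n.+1 :=
  [set t | (forall i, 0 <= t ord0 i) /\ \sum_i t ord0 i = 1].

Definition stdsimplex (n : nat) : topologicalType := set_type (@simplex_set n).

Lemma push_subproof m n (f : 'I_m.+1 -> 'I_n.+1) (t : stdsimplex m) :
  \row_j (\sum_(i | f i == j) set_val t ord0 i) \in @simplex_set n.
Proof.
have [t0 t1] : simplex_set (set_val t) by exact: set_valP.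
apply/mem_set; split=> [j|]; first by rewrite mxE sumr_ge0.
rewrite -t1 [RHS](partition_big f xpredT)//=.
by apply: eq_bigr => j _; rewrite mxE.
Qed.

(* The affine map sending the i-th vertex to the (f i)-th vertex. *)
Definition push m n (f : 'I_m.+1 -> 'I_n.+1) (t : stdsimplex m) : stdsimplex n :=
  exist (fun u => u \in @simplex_set n) _ (push_subproof f t).

Lemma push_coord m n (f : 'I_m.+1 -> 'I_n.+1) (t : stdsimplex m) j :
  set_val (push f t) ord0 j = \sum_(i | f i == j) set_val t ord0 i.
Proof. by rewrite /set_val/= mxE. Qed.

Lemma push_comp m n p (g : 'I_n.+1 -> 'I_p.+1) (f : 'I_m.+1 -> 'I_n.+1) :
  push g \o push f = push (g \o f).
Proof.
apply/funext => t /=; apply: val_inj; apply/rowP => j.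
rewrite [LHS]push_coord [RHS]push_coord [RHS](partition_big f (fun i => g i == j))//=.
apply: eq_bigr => i /eqP gij; rewrite push_coord; apply: eq_bigl => k.
by case: eqP => [->|]; rewrite ?andbF// gij eqxx.
Qed.

Lemma push_continuous m n (f : 'I_m.+1 -> 'I_n.+1) : continuous (push f).
Proof.
apply/continuous_comp_initial => t A /= [P Pnbhs PA].
have coord_cts j : continuous
    (fun u : stdsimplex m => \sum_(i | f i == j) (set_val u ord0 i : R)).
  apply: continuous_big => [|i _ u]; first exact: add_continuous.
  apply: (@continuous_comp _ _ _ (fun u : stdsimplex m => set_val u)
    (fun M : 'rV[R]_m.+1 => M ord0 i)).
    exact: initial_continuous.
  exact: coord_continuous.
have Pt j : nbhs t
    (fun u : stdsimplex m => P ord0 j (\sum_(i | f i == j) (set_val u ord0 i : R))).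
  apply: (coord_cts j t).
  by have := Pnbhs ord0 j; rewrite push_coord.
have : nbhs t (fun u : stdsimplex m =>
    forall j, P ord0 j (\sum_(i | f i == j) (set_val u ord0 i : R))).
  exact: (@filter_forall _ _ _ _ (nbhs_filter t) Pt).
apply: filterS => u Pu; apply: PA => i j.
by rewrite ord1 mxE; exact: Pu.
Qed.

HB.instance Definition _ m n (f : 'I_m.+1 -> 'I_n.+1) :=
  @isContinuous.Build _ _ (push f) (@push_continuous m n f).

End StandardSimplex.

(* A presheaf of sets on the category of the ordinals [n] = 'I_n.+1. *)
Record simplicial_set := SimplicialSet {
  simplex :> nat -> Type;
  simplex_map : forall m n, {omorphism 'I_m.+1 -> 'I_n.+1} -> simplex n -> simplex m;
  simplex_map_id : forall n (x : simplex n), simplex_map idfun x = x;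
  simplex_map_comp : forall m n p (g : {omorphism 'I_n.+1 -> 'I_p.+1})
    (f : {omorphism 'I_m.+1 -> 'I_n.+1}) (x : simplex p),
    simplex_map (g \o f) x = simplex_map f (simplex_map g x)
}.

(* The nondegenerate simplices. *)
Definition faces (X : simplicial_set) n : set (X n) :=
  [set x | ~ exists m (f : {omorphism 'I_n.+1 -> 'I_m.+1}) (y : X m),
     [/\ (m < n)%N, (forall j, exists i, f i = j) & x = simplex_map f y]].
Arguments faces : clear implicits.

Section Realization.
Variables (R : realType) (X : simplicial_set).

Definition simplices : Type := {n & X n}.
HB.instance Definition _ := gen_eqMixin simplices.
HB.instance Definition _ := gen_choiceMixin simplices.

(* The disjoint union of the X n * stdsimplex R n, with X n discrete. *)
Definition cells : topologicalType :=
  {x : simplices & stdsimplex R (projT1 x)}.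

Definition cell n (x : X n) (t : stdsimplex R n) : cells :=
  existT (fun x : simplices => stdsimplex R (projT1 x)) (existT _ n x) t.

Variant glue : cells -> cells -> Prop :=
  Glue m n (f : {omorphism 'I_m.+1 -> 'I_n.+1}) (x : X n) (t : stdsimplex R m) :
    glue (cell (simplex_map f x) t) (cell x (push f t)).

Definition glue_eq : rel cells := fun u v => `[< clos_refl_sym_trans _ glue u v >].

Lemma glue_eq_equiv : equiv_class_of glue_eq.
Proof.
split=> [u|u v|v u w].
- by apply/asboolP; exact: rst_refl.
- by apply/asboolP/asboolP => ?; exact: rst_sym.
- by move=> /asboolP uv /asboolP vw; apply/asboolP; exact: rst_trans uv vw.
Qed.

Canonical glue_eq_rel := EquivRelPack glue_eq_equiv.

Definition realization : topologicalType := quotient_topology {eq_quot glue_eq}.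

Definition characteristic_map n (x : X n) (t : stdsimplex R n) : realization :=
  \pi_realization (cell x t).

Definition closed_face n (x : X n) : set realization :=
  range (characteristic_map x).

End Realization.
Arguments closed_face R [X n] x.
Arguments characteristic_map R [X n] x t.

Definition contractible (R : realType) (T : topologicalType) :=
  exists (c : T) (H : T * R -> T),
    [/\ {within [set: T] `*` `[0, 1], continuous H},
        forall x, H (x, 0) = x & forall x, H (x, 1) = c].

Lemma leibniz_sum (A : comNzRingType) p q (G H : nat -> A) :
  (forall i, (p < i)%N -> G i = G p.+1) ->
  (forall i, (i <= p)%N -> H i = H p) ->
  \sum_(i < (p + q).+2) (-1) ^+ i * (G i * H i) =
  (\sum_(i < p.+2) (-1) ^+ i * G i) * H p +
  (-1) ^+ p * (G p.+1 * \sum_(j < q.+2) (-1) ^+ j * H (p + j)%N).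
Proof.
move=> GE HE.
have -> : (p + q).+2 = (p.+1 + q.+1)%N by rewrite addSn addnS.
rewrite big_split_ord/= [\sum_(i < p.+2) _]big_ord_recr/= [\sum_(j < q.+2) _]big_ord_recl/=.
rewrite expr0 mul1r addn0 mulrDl (mulrDr (G p.+1)) mulrDr.
have -> : (-1) ^+ p.+1 * G p.+1 * H p = - ((-1) ^+ p * (G p.+1 * H p)).
  by rewrite exprS mulN1r !mulNr mulrA.
rewrite addrA addrNK big_distrl/=; congr (_ + _).
  by apply: eq_bigr => i _; rewrite mulrA HE// -ltnS.
rewrite !big_distrr/=; apply: eq_bigr => j _.
rewrite GE ?addSn ?ltnS ?leq_addr// -addnS exprD [RHS]mulrA.
by rewrite /bump/= add1n -!mulrA; congr (_ * _); rewrite mulrCA.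
Qed.

Section SingularCohomology.
Variables (R : realType) (A : comNzRingType) (T : topologicalType).

Definition singular (n : nat) : Type := continuousType (stdsimplex R n) T.

Definition pullback m n (s : singular n) (f : 'I_m.+1 -> 'I_n.+1) : singular m :=
  s \o push f.

Definition cochain (n : nat) : Type := singular n -> A.
HB.instance Definition _ n := GRing.Zmodule.on (cochain n).

Definition coboundary n (a : cochain n) : cochain n.+1 :=
  fun s => \sum_(i < n.+2) (-1) ^+ i * a (pullback s (lift i)).

Lemma coboundaryB n (a b : cochain n) :
  coboundary (a - b) = coboundary a - coboundary b.
Proof.
apply/funext => s; rewrite /coboundary [RHS]/GRing.add/= -sumrB.
by apply: eq_bigr => i _; rewrite -mulrBr.
Qed.

Lemma coboundary0 n : coboundary (0 : cochain n) = 0.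
Proof. by rewrite -(subrr 0) coboundaryB subrr. Qed.

Definition is_cocycle n : {pred cochain n} := fun a => coboundary a == 0.

Lemma is_cocycle_zmod_closed n : zmod_closed (@is_cocycle n).
Proof.
split=> [|a b /eqP az /eqP bz]; apply/eqP; first exact: coboundary0.
by rewrite coboundaryB az bz subrr.
Qed.
HB.instance Definition _ n :=
  GRing.isZmodClosed.Build (cochain n) (@is_cocycle n) (@is_cocycle_zmod_closed n).

Record cocycle n := Cocycle {
  cocycle_val :> cochain n;
  cocycleP : cocycle_val \in @is_cocycle n
}.
HB.instance Definition _ n := [isSub for @cocycle_val n].
HB.instance Definition _ n := [Choice of cocycle n by <:].
HB.instance Definition _ n := [SubChoice_isSubZmodule of cocycle n by <:].

Definition exact_cochain n : cochain n -> Prop :=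
  match n with
  | 0 => fun a => a = 0
  | m.+1 => fun a => exists b : cochain m, a = coboundary b
  end.

Lemma exact_cochain0 n : exact_cochain (0 : cochain n).
Proof. by case: n => [//|n]; exists 0; rewrite coboundary0. Qed.

Lemma exact_cochainB n (a b : cochain n) :
  exact_cochain a -> exact_cochain b -> exact_cochain (a - b).
Proof.
case: n a b => [|n] a b /=; first by move=> -> ->; rewrite subrr.
by move=> [c ->] [d ->]; exists (c - d); rewrite coboundaryB.
Qed.

Definition exact_cocycle n : {pred cocycle n} :=
  fun a => `[< exact_cochain (cocycle_val a) >].

Lemma exact_cocycle_zmod_closed n : zmod_closed (@exact_cocycle n).
Proof.
split=> [|a b /asboolP az /asboolP bz]; apply/asboolP; first exact: exact_cochain0.
exact: exact_cochainB.
Qed.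
HB.instance Definition _ n :=
  GRing.isZmodClosed.Build (cocycle n) (@exact_cocycle n)
    (@exact_cocycle_zmod_closed n).

Definition cohomology n : zmodType := Quotient.quot (@exact_cocycle n).

Lemma pullback_comp m n p (s : singular p) (f : 'I_n.+1 -> 'I_p.+1)
    (g : 'I_m.+1 -> 'I_n.+1) :
  pullback (pullback s f) g = pullback s (f \o g).
Proof. by apply/continuousEP => t; rewrite /pullback/= -push_comp. Qed.

Definition front p q (i : 'I_p.+1) : 'I_(p + q).+1 := inord i.
Definition back p q (j : 'I_q.+1) : 'I_(p + q).+1 := inord (p + j).

Definition cup p q (a : cochain p) (b : cochain q) : cochain (p + q) :=
  fun s => a (pullback s (front q)) * b (pullback s (@back p q)).

Lemma cupBl p q (a a' : cochain p) (b : cochain q) :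
  cup (a - a') b = cup a b - cup a' b.
Proof. by apply/funext => s; rewrite /cup mulrBl. Qed.

Lemma cupBr p q (a : cochain p) (b b' : cochain q) :
  cup a (b - b') = cup a b - cup a b'.
Proof. by apply/funext => s; rewrite /cup mulrBr. Qed.

(* Stated for any N equal to (p + q).+1 because p + q.+1 is not convertible to it. *)
Lemma leibniz p q N (a : cochain p) (b : cochain q) (s : singular N) :
  N = (p + q).+1 ->
  \sum_(i < (p + q).+2)
     (-1) ^+ i * cup a b (pullback s (fun k => inord (bump i k))) =
  coboundary a (pullback s (fun k => inord k)) *
    b (pullback s (fun k => inord (p.+1 + k))) +
  (-1) ^+ p * (a (pullback s (fun k => inord k)) *
    coboundary b (pullback s (fun k => inord (p + k)))).
Proof.
move=> NE.
pose G i := a (pullback s (fun k => inord (bump i k))).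
pose H i := b (pullback s (fun k => inord (bump i (p + k)))).
have pullback_eq m (f g : 'I_m.+1 -> 'I_N.+1) :
  f =1 g -> pullback s f = pullback s g by move/funext ->.
have GE i : (p < i)%N -> G i = a (pullback s (fun k => inord k)).
  move=> pi; congr (a _); apply: pullback_eq => k; congr inord.
  by rewrite /bump leqNgt (leq_trans (ltn_ord k)).
have HE i : (i <= p)%N -> H i = b (pullback s (fun k => inord (p.+1 + k))).
  move=> pi; congr (b _); apply: pullback_eq => k; congr inord.
  by rewrite /bump (leq_trans pi) ?leq_addr.
have cupE (i : 'I_(p + q).+2) :
    cup a b (pullback s (fun k => inord (bump i k))) = G i * H i.
  rewrite /cup !pullback_comp; congr (a _ * b _); apply: pullback_eq => k /=.
    have kpq : (k < (p + q).+1)%N by rewrite (leq_trans (ltn_ord k)) ?ltnS ?leq_addr.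
    by rewrite /front (inordK kpq).
  have kpq : (p + k < (p + q).+1)%N by rewrite ltnS leq_add2l; exact: ltn_ord k.
  by rewrite /back (inordK kpq).
under eq_bigr => i _ do rewrite cupE.
rewrite leibniz_sum; last 2 first.
- by move=> i pi; rewrite !GE.
- by move=> i pi; rewrite !HE.
rewrite GE// HE//; congr (_ * _ + _ * (_ * _)); apply: eq_bigr => i _.
  by rewrite pullback_comp; congr (_ * a _); apply: pullback_eq.
rewrite pullback_comp; congr (_ * b _); apply: pullback_eq => k /=; congr inord.
by rewrite /bump leq_add2l addnCA.
Qed.

Lemma cup_is_cocycle p q (a : cocycle p) (b : cocycle q) :
  cup a b \in @is_cocycle (p + q).
Proof.
apply/eqP/funext => s; rewrite /coboundary.
under eq_bigr => i _.
  rewrite (_ : lift i = fun k => inord (bump i k)); last first.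
    by apply/funext => k; apply/val_inj; rewrite /= inordK//; exact: ltn_ord (lift i k).
  over.
rewrite (leibniz a b s erefl) (eqP (cocycleP a)) (eqP (cocycleP b)).
by rewrite mul0r !mulr0 addr0.
Qed.

Definition cup_cocycle p q (a : cocycle p) (b : cocycle q) : cocycle (p + q) :=
  Cocycle (cup_is_cocycle a b).

Lemma exact_face m N (psi : cochain m) (phi : cochain N) : N = m.+1 ->
  (forall s, phi s = \sum_(i < m.+2)
     (-1) ^+ i * psi (pullback s (fun k => inord (bump i k)))) ->
  exact_cochain phi.
Proof.
move=> NE; subst N => phiE; exists psi; apply/funext => s; rewrite phiE.
apply: eq_bigr => i _; congr (_ * psi (pullback s _)).
by apply/funext => k; apply/val_inj; rewrite /= inordK//; exact: ltn_ord (lift i k).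
Qed.

Lemma exact_cupl p q (a : cochain p) (b : cocycle q) :
  exact_cochain a -> exact_cochain (cup a b).
Proof.
case: p a => [|p] a; rewrite [exact_cochain a]/=.
  by move=> ->; rewrite -(subrr 0) cupBl subrr; exact: exact_cochain0.
move=> [c ->]; apply: (@exact_face (p + q) _ (cup c b)) => // s.
rewrite (leibniz c b s erefl) (eqP (cocycleP b)).
by rewrite !mulr0 addr0.
Qed.

Lemma exact_cupr p q (a : cocycle p) (b : cochain q) :
  exact_cochain b -> exact_cochain (cup a b).
Proof.
case: q b => [|q] b; rewrite [exact_cochain b]/=.
  by move=> ->; rewrite -(subrr 0) cupBr subrr; exact: exact_cochain0.
move=> [c ->].
apply: (@exact_face (p + q) _ (fun s => (-1) ^+ p * cup a c s)); first exact: addnS.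
move=> s; under eq_bigr do rewrite mulrCA.
rewrite -big_distrr/= (leibniz a c s (addnS _ _)) (eqP (cocycleP a)).
by rewrite mul0r add0r signrMK.
Qed.

(* Well defined by pi_cup_class. *)
Definition cup_class p q (x : cohomology p) (y : cohomology q) : cohomology (p + q) :=
  \pi_(cohomology (p + q)) (cup_cocycle (repr x) (repr y)).

Lemma pi_cup_class p q (a : cocycle p) (b : cocycle q) :
  cup_class (\pi_(cohomology p) a) (\pi_(cohomology q) b) =
  \pi_(cohomology (p + q)) (cup_cocycle a b).
Proof.
apply/eqP; rewrite -Quotient.idealrBE; apply/asboolP => /=.
set a' := repr _; set b' := repr _.
have /asboolP aa' : a - a' \in @exact_cocycle p.
  by rewrite Quotient.idealrBE reprK.
have /asboolP bb' : b' - b \in @exact_cocycle q.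
  by rewrite Quotient.idealrBE reprK.
rewrite (_ : cup a' b' - cup a b = cup a' (b' - b) - cup (a - a') b).
  by apply: exact_cochainB; [exact: exact_cupr | exact: exact_cupl].
by rewrite cupBl cupBr opprB addrA subrK.
Qed.

Lemma one_is_cocycle : (fun=> 1) \in @is_cocycle 0.
Proof.
apply/eqP/funext => s; rewrite /coboundary !big_ord_recr big_ord0/=.
by rewrite add0r expr0 expr1 !mulr1 subrr.
Qed.

Definition one_class : cohomology 0 := \pi_(cohomology 0) (Cocycle one_is_cocycle).

Fixpoint cup_prod n : ('I_n -> cohomology 1) -> cohomology n :=
  match n with
  | 0 => fun=> one_class
  | m.+1 => fun xi => cup_class (xi ord0) (cup_prod (fun i => xi (lift ord0 i)))
  end.

End SingularCohomology.

(* Main.v *)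
(* The idea is to count at random. Write a_i for a singular cocycle representing xi_i.
   Correcting a_i by the coboundary of a function h_i on vertices changes its value on an
   edge vw by h_i(v) + h_i(w). Contractibility of the closed faces makes a_i vanish on
   edges that are loops, so the functions h_i can be chosen one after the other in such a
   way that each of them halves the number of n-dimensional faces v_0 ... v_n on which
   the corrected cocycles are all nonzero on the consecutive edges v_(i-1) v_i. If there
   are fewer than 2^n faces, none survives. For simplicial cohomology this says that the
   cup product of the corrected cocycles is zero; the rest of the argument transfers
   this to the singular cohomology of the realization.

   The class xi_i defines a real line bundle, and the corrected cocycle a section of it:
   cut [0, 1] into n blocks, view a point of a simplex as a partition of [0, 1] into
   intervals labelled by the vertices, and integrate over the i-th block the sign of the
   vertex. At a common zero of the n sections, each a_i jumps inside the i-th block, which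
   yields a surviving face. So the open sets U_i where the i-th section does not vanish
   cover the realization. The sign of the section is a primitive of a_i on U_i: this is
   clear for paths inside a cell, and an arbitrary path is treated locally, pushing it
   radially out of the cells of top dimension. Finally, a product of cocycles of which
   the i-th vanishes on the simplices in U_i vanishes on all small simplices, hence is
   exact by barycentric subdivision. *)
From HB Require Import structures.
Require Import Defs.
From mathcomp Require Import all_boot all_order all_algebra generic_quotient.
From mathcomp Require Import all_classical all_reals all_analysis.
From mathcomp Require Import ring lra zify.
Set Implicit Arguments.
Unset Strict Implicit.
Unset Printing Implicit Defensive.
Import Order.TTheory GRing.Theory Num.Theory.
Import numFieldNormedType.Exports.
Local Open Scope classical_set_scope.
Local Open Scope ring_scope.
Local Open Scope quotient_scope.

(** * Barycentric coordinates and holonomy along paths *)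

Section GlobalContinuity.
Variables (R : realType) (T : topologicalType).
Implicit Types f g : T -> R.

Lemma cts_cst (Z : topologicalType) (z : Z) : continuous (fun _ : T => z).
Proof. by move=> x; exact: cvg_cst. Qed.

Lemma cts_comp (Z W : topologicalType) (f : T -> Z) (g : Z -> W) :
  continuous f -> continuous g -> continuous (fun x => g (f x)).
Proof. by move=> cf cg x; apply: continuous_comp; [exact: cf|exact: cg]. Qed.

Lemma ctsD f g : continuous f -> continuous g -> continuous (fun x => f x + g x).
Proof. by move=> cf cg x; apply: cvgD; [exact: cf|exact: cg]. Qed.

Lemma ctsN f : continuous f -> continuous (fun x => - f x).
Proof. by move=> cf x; apply: cvgN; exact: cf. Qed.

Lemma ctsB f g : continuous f -> continuous g -> continuous (fun x => f x - g x).
Proof. by move=> cf cg; apply: ctsD => //; exact: ctsN. Qed.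

Lemma ctsM f g : continuous f -> continuous g -> continuous (fun x => f x * g x).
Proof. by move=> cf cg x; apply: cvgM; [exact: cf|exact: cg]. Qed.

Lemma ctsV f : (forall x, f x != 0) -> continuous f -> continuous (fun x => (f x)^-1).
Proof. by move=> f0 cf x; apply: cvgV; [exact: f0|exact: cf]. Qed.

Lemma cts_min f g : continuous f -> continuous g -> continuous (fun x => Num.min (f x) (g x)).
Proof. by move=> cf cg x; apply: continuous_min; [exact: cf|exact: cg]. Qed.

Lemma cts_max f g : continuous f -> continuous g -> continuous (fun x => Num.max (f x) (g x)).
Proof. by move=> cf cg x; apply: continuous_max; [exact: cf|exact: cg]. Qed.

Lemma cts_sum (I : Type) (r : seq I) (P : pred I) (F : I -> T -> R) :
  (forall i, continuous (F i)) -> continuous (fun x => \sum_(i <- r | P i) F i x).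
Proof.
by move=> cF; apply: continuous_big => [|i _]; [exact: add_continuous|exact: cF].
Qed.

Lemma cts_pair (Z W : topologicalType) (f : T -> Z) (g : T -> W) :
  continuous f -> continuous g -> continuous (fun x => (f x, g x)).
Proof. by move=> cf cg x; apply: cvg_pair; [exact: cf|exact: cg]. Qed.

Lemma cts_fst (Z W : topologicalType) (f : T -> Z * W) :
  continuous f -> continuous (fun x => (f x).1).
Proof. by move=> cf x; apply: (cvg_comp _ _ (cf x)); exact: cvg_fst. Qed.

Lemma cts_snd (Z W : topologicalType) (f : T -> Z * W) :
  continuous f -> continuous (fun x => (f x).2).
Proof. by move=> cf x; apply: (cvg_comp _ _ (cf x)); exact: cvg_snd. Qed.

Lemma cts_id : continuous (fun x : T => x).
Proof. by move=> x; exact: cvg_id. Qed.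

End GlobalContinuity.

Lemma continuous_prodP (S T Z : topologicalType) (f : S * T -> Z) :
  (forall u r V, open V -> V (f (u, r)) -> exists A B,
     [/\ nbhs u A, nbhs r B & forall u' r', A u' -> B r' -> V (f (u', r'))]) ->
  continuous f.
Proof.
move=> H [u r] W; rewrite /= nbhsE => -[V [oV Vur] VW].
have [A [B [uA rB AB]]] := H u r V oV Vur.
by exists (A, B) => // -[u' r'] /= [Au Br]; apply: VW; exact: AB.
Qed.

Section Barycentric.
Variable R : realType.
Implicit Types n m k : nat.

Definition bc n (t : stdsimplex R n) (i : 'I_n.+1) : R := set_val t ord0 i.

Lemma bc_ge0 n (t : stdsimplex R n) i : 0 <= bc t i.
Proof.
have [t0 _] : simplex_set (set_val t) by exact: set_valP.
exact: t0.
Qed.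

Lemma bc_sum n (t : stdsimplex R n) : \sum_i bc t i = 1.
Proof.
have [_ t1] : simplex_set (set_val t) by exact: set_valP.
exact: t1.
Qed.

Lemma bc_le1 n (t : stdsimplex R n) i : bc t i <= 1.
Proof.
rewrite -(bc_sum t) (bigD1 i)//= lerDl sumr_ge0// => j _; exact: bc_ge0.
Qed.

Lemma bc_inj n (t u : stdsimplex R n) : bc t =1 bc u -> t = u.
Proof. by move=> tu; apply: val_inj; apply/rowP => j; exact: tu. Qed.

Lemma bc_push m n (f : 'I_m.+1 -> 'I_n.+1) (t : stdsimplex R m) j :
  bc (push f t) j = \sum_(i | f i == j) bc t i.
Proof. exact: push_coord. Qed.

Lemma mksimplex_subproof n (f : 'I_n.+1 -> R) :
  (forall i, 0 <= f i) /\ \sum_i f i = 1 -> \row_i f i \in @simplex_set R n.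
Proof.
move=> [f0 f1]; apply/mem_set; split=> [i|]; first by rewrite mxE.
by rewrite -f1; apply: eq_bigr => i _; rewrite mxE.
Qed.

Definition mksimplex n (f : 'I_n.+1 -> R) (fP : (forall i, 0 <= f i) /\ \sum_i f i = 1)
  : stdsimplex R n := exist (fun u => u \in @simplex_set R n) _ (mksimplex_subproof fP).

Lemma bc_mksimplex n (f : 'I_n.+1 -> R) fP i : bc (@mksimplex n f fP) i = f i.
Proof. by rewrite /bc /set_val/= mxE. Qed.

Lemma bc_continuous n (i : 'I_n.+1) : continuous (fun t : stdsimplex R n => bc t i).
Proof.
move=> t; apply: (@continuous_comp _ _ _ (fun u : stdsimplex R n => set_val u)
    (fun M : 'rV[R]_n.+1 => M ord0 i)).
  exact: initial_continuous.
exact: coord_continuous.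
Qed.

Lemma continuous_bc (T : topologicalType) n (f : T -> stdsimplex R n) :
  (forall i, continuous (fun x => bc (f x) i)) -> continuous f.
Proof.
move=> cf; apply/continuous_comp_initial => t A /= [P Pnbhs PA].
have : nbhs t (fun u => forall j, P ord0 j (bc (f u) j)).
  apply: (@filter_forall _ _ _ _ (nbhs_filter t)) => j.
  apply: (cf j t); exact: (Pnbhs ord0 j).
by apply: filterS => u Pu; apply: PA => i j; rewrite ord1; exact: Pu.
Qed.

Lemma vertex_subproof n (j : 'I_n.+1) :
  (forall i : 'I_n.+1, 0 <= (i == j)%:R :> R) /\ \sum_i (i == j)%:R = 1 :> R.
Proof.
split=> [i|]; first by rewrite ler0n.
by rewrite (bigD1 j)//= eqxx big1 ?addr0// => i /negbTE ->.
Qed.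

Definition vertex n (j : 'I_n.+1) : stdsimplex R n := mksimplex (vertex_subproof j).

Lemma bc_vertex n (j i : 'I_n.+1) : bc (vertex j) i = (i == j)%:R.
Proof. exact: bc_mksimplex. Qed.

Lemma push_vertex m n (f : 'I_m.+1 -> 'I_n.+1) j : push f (vertex j) = vertex (f j).
Proof.
apply: bc_inj => i; rewrite bc_push bc_vertex eq_sym.
case: eqP => [<-|/eqP fji].
  rewrite (bigD1 j)//= bc_vertex eqxx big1 ?addr0// => k /andP[_ /negbTE kj].
  by rewrite bc_vertex kj.
rewrite big1// => k /eqP fk; rewrite bc_vertex; case: eqP => // kj.
by rewrite -kj fk eqxx in fji.
Qed.

Lemma affine_subproof k n (w : 'I_k.+1 -> stdsimplex R n) (t : stdsimplex R k) :
  (forall i, 0 <= \sum_j bc t j * bc (w j) i) /\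
  \sum_i \sum_j bc t j * bc (w j) i = 1.
Proof.
split=> [i|]; first by apply: sumr_ge0 => j _; rewrite mulr_ge0 ?bc_ge0.
rewrite exchange_big/= -(bc_sum t); apply: eq_bigr => j _.
by rewrite -big_distrr/= bc_sum mulr1.
Qed.

Definition affine k n (w : 'I_k.+1 -> stdsimplex R n) (t : stdsimplex R k)
  : stdsimplex R n := mksimplex (affine_subproof w t).

Lemma bc_affine k n (w : 'I_k.+1 -> stdsimplex R n) t i :
  bc (affine w t) i = \sum_j bc t j * bc (w j) i.
Proof. exact: bc_mksimplex. Qed.

Lemma affine_continuous k n (w : 'I_k.+1 -> stdsimplex R n) : continuous (affine w).
Proof.
apply: continuous_bc => i; under eq_fun do rewrite bc_affine.
by apply: cts_sum => j; apply: ctsM; [exact: bc_continuous | exact: cts_cst].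
Qed.

Lemma affine_push m k n (w : 'I_k.+1 -> stdsimplex R n) (f : 'I_m.+1 -> 'I_k.+1) t :
  affine w (push f t) = affine (w \o f) t.
Proof.
apply: bc_inj => i; rewrite !bc_affine [RHS](partition_big f xpredT)//=.
apply: eq_bigr => j _; rewrite bc_push big_distrl/=.
by apply: eq_bigr => l /eqP ->.
Qed.

Lemma push_affine k n m (f : 'I_n.+1 -> 'I_m.+1) (w : 'I_k.+1 -> stdsimplex R n) t :
  push f (affine w t) = affine (push f \o w) t.
Proof.
apply: bc_inj => i; rewrite bc_push bc_affine.
under eq_bigr do rewrite bc_affine.
rewrite exchange_big/=; apply: eq_bigr => j _.
by rewrite /= bc_push big_distrr.
Qed.

Lemma affine_vertex k n (w : 'I_k.+1 -> stdsimplex R n) j : affine w (vertex j) = w j.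
Proof.
apply: bc_inj => i; rewrite bc_affine (bigD1 j)//= bc_vertex eqxx mul1r big1 ?addr0//.
by move=> l /negbTE lj; rewrite bc_vertex lj mul0r.
Qed.

Lemma affine_vertices n t : affine (@vertex n) t = t.
Proof.
apply: bc_inj => i; rewrite bc_affine (bigD1 i)//= bc_vertex eqxx mulr1 big1 ?addr0//.
by move=> l /negbTE li; rewrite bc_vertex eq_sym li mulr0.
Qed.

End Barycentric.

Lemma addrr_F2 (x : 'F_2) : x + x = 0.
Proof. exact: (addrr_pchar2 (pchar_Fp (isT : prime 2))). Qed.

Lemma oppr_F2 (x : 'F_2) : - x = x.
Proof. exact: (oppr_pchar2 (pchar_Fp (isT : prime 2))). Qed.

Lemma signr_F2 n : (-1) ^+ n = 1 :> 'F_2.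
Proof. by rewrite oppr_F2 expr1n. Qed.

Lemma neq0_F2 (x : 'F_2) : x != 0 -> x = 1.
Proof. by case: x => -[|[|//]] i //= _; apply/val_inj. Qed.

Section Evaluation.
Variables (R : realType) (Y : topologicalType).

(** Cochains are defined on bundled continuous maps. [ev] accepts any function, with the default
    value 0 on discontinuous ones, so that simplices can be rewritten as plain functions. *)
Definition ev n (a : cochain R 'F_2 Y n) (f : stdsimplex R n -> Y) : 'F_2 :=
  match pselect (continuous f) with
  | left cf => a (mkcts cf)
  | right _ => 0
  end.

Lemma ev_singular n (a : cochain R 'F_2 Y n) (s : singular R Y n) : ev a s = a s.
Proof.
rewrite /ev; case: pselect => [cs|[]]; last exact: cts_fun.
by congr (a _); apply/continuousEP => t.
Qed.

Lemma ev_cocycle n (a : cochain R 'F_2 Y n) (f : stdsimplex R n.+1 -> Y) :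
  coboundary a = 0 -> continuous f ->
  \sum_(i < n.+2) ev a (f \o push (lift i)) = 0.
Proof.
move=> az cf.
have := congr1 (fun c : cochain R 'F_2 Y n.+1 => c (mkcts cf)) az.
rewrite /coboundary => E; apply: etrans E; apply: eq_bigr => i _.
by rewrite signr_F2 mul1r -ev_singular.
Qed.

Definition segment (A B : R * R) (t : stdsimplex R 1) : R * R :=
  (bc t ord0 * A.1 + bc t ord_max * B.1, bc t ord0 * A.2 + bc t ord_max * B.2).

(** [G] lives on the whole plane: no subspace topology intervenes, and one notion serves both paths
    and homotopies. *)
Definition holonomy (a : cochain R 'F_2 Y 1) (G : R * R -> Y) A B : 'F_2 :=
  ev a (G \o segment A B).

(** This is the cocycle condition on the image under [G] of the affine triangle with vertices [A],
    [B], [C]; signs disappear modulo two. *)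
Lemma holonomyD (a : cochain R 'F_2 Y 1) (G : R * R -> Y) A B C :
  coboundary a = 0 -> continuous G ->
  holonomy a G A C = holonomy a G A B + holonomy a G B C.
Proof.
move=> az cG.
pose i2 : 'I_3 := @Ordinal 3 2 isT.
pose i1 : 'I_3 := @Ordinal 3 1 isT.
pose tri (t : stdsimplex R 2) : R * R :=
  (bc t ord0 * A.1 + bc t i1 * B.1 + bc t i2 * C.1,
   bc t ord0 * A.2 + bc t i1 * B.2 + bc t i2 * C.2).
have ctri : continuous tri.
  by apply: cts_pair; (do !apply: ctsD); apply: ctsM;
    by [exact: bc_continuous|exact: cts_cst].
have := @ev_cocycle 1 a (G \o tri) az; rewrite !big_ord_recl big_ord0 addr0.
have bcp (t : stdsimplex R 1) (f : 'I_2 -> 'I_3) j :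
    bc (push f t) j = bc t ord0 *+ (f ord0 == j) + bc t ord_max *+ (f ord_max == j).
  rewrite bc_push big_mkcond/= big_ord_recl big_ord1 !mulrb.
  by rewrite (_ : lift ord0 ord0 = ord_max)//; exact/val_inj.
have -> : (G \o tri) \o push (lift ord0) = G \o segment B C.
  apply/funext => t; rewrite /tri/segment/= !bcp !mulr1n !mulr0n.
  by rewrite !(addr0, add0r, mul0r).
have -> : (G \o tri) \o push (lift (lift ord0 ord0)) = G \o segment A C.
  apply/funext => t; rewrite /tri/segment/= !bcp !mulr1n !mulr0n.
  by rewrite !(addr0, add0r, mul0r).
have -> : (G \o tri) \o push (lift (lift ord0 (lift ord0 ord0))) = G \o segment A B.
  apply/funext => t; rewrite /tri/segment/= !bcp !mulr1n !mulr0n.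
  by rewrite !(addr0, add0r, mul0r).
move=> /(_ (cts_comp ctri cG)) /eqP; rewrite /holonomy addrCA addr_eq0 oppr_F2.
by rewrite addrC => /eqP.
Qed.

Lemma holonomyxx (a : cochain R 'F_2 Y 1) (G : R * R -> Y) A :
  coboundary a = 0 -> continuous G -> holonomy a G A A = 0.
Proof.
move=> az cG; have := holonomyD A A A az cG.
by move/eqP; rewrite eq_sym -subr_eq0 addrK => /eqP.
Qed.

Definition path_holonomy (a : cochain R 'F_2 Y 1) (g : R -> Y) u v : 'F_2 :=
  holonomy a (fun p => g p.1) (u, 0) (v, 0).

Lemma path_holonomyD (a : cochain R 'F_2 Y 1) (g : R -> Y) u v w :
  coboundary a = 0 -> continuous g ->
  path_holonomy a g u w = path_holonomy a g u v + path_holonomy a g v w.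
Proof.
move=> az cg; apply: holonomyD => //.
by apply: cts_comp cg; apply: cts_fst; exact: cts_id.
Qed.

Lemma path_holonomyxx (a : cochain R 'F_2 Y 1) (g : R -> Y) u :
  coboundary a = 0 -> continuous g -> path_holonomy a g u u = 0.
Proof.
move=> az cg; apply: holonomyxx => //.
by apply: cts_comp cg; apply: cts_fst; exact: cts_id.
Qed.

Lemma bc1D (t : stdsimplex R 1) : bc t ord0 + bc t ord_max = 1.
Proof.
rewrite -(bc_sum t) big_ord_recl big_ord1; congr (_ + bc t _); exact/val_inj.
Qed.

Lemma holonomy_row (a : cochain R 'F_2 Y 1) (G : R * R -> Y) u v w :
  holonomy a G (u, w) (v, w) = path_holonomy a (fun r => G (r, w)) u v.
Proof.
rewrite /path_holonomy/holonomy; congr ev; apply/funext => t.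
by rewrite /segment/= -mulrDl bc1D mul1r.
Qed.

Lemma holonomy_col (a : cochain R 'F_2 Y 1) (G : R * R -> Y) u v w :
  holonomy a G (w, u) (w, v) = path_holonomy a (fun r => G (w, r)) u v.
Proof.
rewrite /path_holonomy/holonomy; congr ev; apply/funext => t.
by rewrite /segment/= -mulrDl bc1D mul1r.
Qed.

(** Both ways around the square are compared with the diagonal from [(u, 0)] to [(v, 1)]. For a
    homotopy [G], the holonomy changes by that of the tracks of the two ends. *)
Lemma square_holonomy (a : cochain R 'F_2 Y 1) (G : R * R -> Y) u v :
  coboundary a = 0 -> continuous G ->
  path_holonomy a (fun r => G (r, 0)) u v =
  path_holonomy a (fun r => G (r, 1)) u v +
  path_holonomy a (fun r => G (u, r)) 0 1 + path_holonomy a (fun r => G (v, r)) 0 1.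
Proof.
move=> az cG; rewrite -!holonomy_row -!holonomy_col.
have := holonomyD (u, 0) (v, 0) (v, 1) az cG.
rewrite (holonomyD (u, 0) (u, 1) (v, 1) az cG) => /eqP.
rewrite -subr_eq oppr_F2 => /eqP <-; congr (_ + _); exact: addrC.
Qed.

End Evaluation.

Section UnitInterval.
Variable R : realType.

(** For [u <= v], the retraction of the line onto [u, v]. It makes maps on an interval total, and
    later measures how intervals intersect. *)
Definition clamp (u v r : R) : R := Num.max u (Num.min v r).

Lemma clamp_continuous u v : continuous (clamp u v).
Proof.
apply: cts_max; first exact: cts_cst.
by apply: cts_min; [exact: cts_cst|exact: cts_id].
Qed.

Lemma clamp_itv u v r : u <= v -> u <= clamp u v r <= v.
Proof. by move=> uv; rewrite /clamp le_max lexx ge_max uv ge_min lexx. Qed.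

Lemma clamp_id u v r : u <= r <= v -> clamp u v r = r.
Proof. by move=> /andP[ur rv]; rewrite /clamp min_r// max_r. Qed.

Lemma interval_point_subproof (r : R) (f := fun i : 'I_2 =>
    if i == ord0 then 1 - clamp 0 1 r else clamp 0 1 r) :
  (forall i, 0 <= f i) /\ \sum_i f i = 1.
Proof.
have /andP[c0 c1] := clamp_itv r (@ler01 R).
split=> [i|]; first by rewrite /f; case: ifP; rewrite ?subr_ge0.
by rewrite /f big_ord_recl big_ord1/= subrK.
Qed.

Definition interval_point (r : R) : stdsimplex R 1 :=
  mksimplex (interval_point_subproof r).

Lemma interval_point_continuous : continuous interval_point.
Proof.
apply: continuous_bc => i; under eq_fun do rewrite bc_mksimplex.
case: (i == ord0); last exact: clamp_continuous.
by apply: ctsB; [exact: cts_cst|exact: clamp_continuous].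
Qed.

Lemma interval_point_bc (t : stdsimplex R 1) : interval_point (bc t ord_max) = t.
Proof.
apply: bc_inj => i; rewrite bc_mksimplex clamp_id ?bc_ge0 ?bc_le1//.
case: eqP => [->|/eqP i0]; first by rewrite -(bc1D t) addrK.
by congr (bc t _); apply/val_inj; case: i i0 => -[|[]].
Qed.

Lemma interval_point0 : interval_point 0 = vertex R ord0.
Proof.
apply: bc_inj => i; rewrite bc_mksimplex bc_vertex clamp_id ?lexx ?ler01//.
by case: eqP; rewrite ?subr0.
Qed.

Lemma interval_point1 : interval_point 1 = vertex R ord_max.
Proof.
apply: bc_inj => i; rewrite bc_mksimplex bc_vertex clamp_id ?lexx ?ler01//.
by case: i => -[|[]]//= ilt; rewrite /eq_op/= ?subrr.
Qed.

Lemma path_holonomy_singular (Y : topologicalType) (a : cochain R 'F_2 Y 1)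
    (f : stdsimplex R 1 -> Y) :
  path_holonomy a (f \o interval_point) 0 1 = ev a f.
Proof.
rewrite /path_holonomy/holonomy; congr ev; apply/funext => t.
by rewrite /segment/= mulr0 mulr1 add0r interval_point_bc.
Qed.

End UnitInterval.

(** * Simplicial operators *)

Section MonotoneMaps.

Definition monotone_map m n (f : 'I_m.+1 -> 'I_n.+1)
    (fm : {homo f : i j / (i <= j)%N}) : {omorphism 'I_m.+1 -> 'I_n.+1} :=
  HB.pack f (@Order.isOrderMorphism.Build _ _ _ _ f fm).

Lemma omorphism_ext m n (f g : {omorphism 'I_m.+1 -> 'I_n.+1}) : f =1 g -> f = g.
Proof.
move=> /funext; case: f => f [[fm]]; case: g => g [[gm]] /= fg.
by subst g; rewrite (Prop_irrelevance fm gm).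
Qed.

Lemma omorphism_homo m n (f : {omorphism 'I_m.+1 -> 'I_n.+1}) :
  {homo f : i j / (i <= j)%N}.
Proof. by move=> i j ij; have := @omorph_le _ _ _ _ f i j; rewrite !leEord; apply. Qed.

(** Such a map is strictly increasing, so [i <= f i]. As [f] permutes the indices, both sides have
    the same sum, and all these inequalities are equalities. *)
Lemma monotone_injective_id n (f : 'I_n -> 'I_n) :
  {homo f : i j / (i <= j)%N} -> injective f -> f =1 id.
Proof.
move=> fm fi.
have sm (i j : 'I_n) : (i < j)%N -> (f i < f j)%N.
  move=> ij; rewrite ltn_neqAle fm 1?ltnW// andbT.
  by apply: contraTneq ij => /val_inj/fi ->; rewrite ltnn.
have le_f k (i : 'I_n) : val i = k -> (i <= f i)%N.
  elim: k i => [|k IH] i ik; first by rewrite ik.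
  have kn : (k < n)%N by rewrite (leq_trans _ (ltn_ord i))// ik.
  rewrite ik (leq_ltn_trans (IH (Ordinal kn) erefl))// sm//= ik; exact: ltnSn.
have := @leqif_sum _ xpredT (fun i : 'I_n => i == f i :> nat)
   (fun i : 'I_n => (i : nat)) (fun i => (f i : nat)).
case=> [i _|_]; first by split=> //; exact: le_f.
have -> : (\sum_(i < n) f i = \sum_(i < n) i)%N by rewrite [RHS](reindex_inj fi).
rewrite eqxx.
by move=> /esym/forallP E i; have /eqP /val_inj <- := E i.
Qed.

(** Any section of a monotone surjection is monotone, so its values can be chosen freely, in
    particular the one at [f k]. *)
Lemma surjection_section m n (f : {omorphism 'I_m.+1 -> 'I_n.+1}) (k : 'I_m.+1) :
  (forall j, exists i, f i = j) ->
  exists s : {omorphism 'I_n.+1 -> 'I_m.+1}, (forall j, f (s j) = j) /\ s (f k) = k.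
Proof.
move=> /choice[s0 fs0].
pose s j := if j == f k then k else s0 j.
have fs j : f (s j) = j by rewrite /s; case: eqP => [->|_].
have sm : {homo s : i j / (i <= j)%N}.
  move=> i j ij; rewrite leqNgt; apply/negP => sji.
  have := omorphism_homo f (ltnW sji); rewrite !fs => ji.
  have /val_inj ijE : val i = val j by apply/eqP; rewrite eqn_leq ij ji.
  by rewrite ijE ltnn in sji.
exists (monotone_map sm); split=> [j|]; first exact: fs.
by rewrite /= /s eqxx.
Qed.

Lemma monotone_noninjective n m (f : 'I_n.+2 -> 'I_m.+1) :
  {homo f : i j / (i <= j)%N} -> ~ injective f ->
  exists i : 'I_n.+1, f (widen_ord (leqnSn _) i) = f (lift ord0 i).
Proof.
move=> fm finj; apply: contrapT => H; apply: finj.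
have step (i : 'I_n.+1) : (f (widen_ord (leqnSn _) i) < f (lift ord0 i))%N.
  rewrite ltn_neqAle; apply/andP; split; last by apply: fm; rewrite /= /bump/=; lia.
  by apply/eqP => /val_inj E; apply: H; exists i.
have sm (i j : 'I_n.+2) : (i < j)%N -> (f i < f j)%N.
  move=> ij; have jn : (j.-1 < n.+1)%N by have := ltn_ord j; lia.
  have := step (Ordinal jn).
  have -> : lift ord0 (Ordinal jn) = j by apply/val_inj => /=; rewrite /bump/=; lia.
  by apply: leq_ltn_trans; apply: fm => /=; lia.
move=> i j fij; apply/val_inj.
by have [/sm|/sm|//] := ltngtP i j; rewrite fij ltnn.
Qed.

End MonotoneMaps.

Section Degeneracy.
Variable X : simplicial_set.

Lemma simplex_map_ext m n (f g : {omorphism 'I_m.+1 -> 'I_n.+1}) (x : X n) :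
  f =1 g -> simplex_map f x = simplex_map g x.
Proof. by move=> /omorphism_ext ->. Qed.

Lemma noninjective_degenerate m n (f : {omorphism 'I_n.+1 -> 'I_m.+1}) (y : X m) :
  ~ injective f -> ~ faces X n (simplex_map f y).
Proof.
case: n f => [|n] f finj; first by case: finj => i j _; rewrite !ord1.
have [i fi] := monotone_noninjective (@omorphism_homo _ _ f) finj.
apply.
(* As [f] agrees at [i] and [i.+1], it is unchanged by first collapsing these two indices with
   [unbump i] and then including back with [i.+1] skipped. *)
have dm : {homo @lift n.+2 (lift ord0 i) : k l / (k <= l)%N}.
  by move=> k l kl /=; rewrite leq_bump2.
have sm : {homo (fun k : 'I_n.+2 => inord (unbump i k) : 'I_n.+1) : k l / (k <= l)%N}.
  move=> k l kl; have := ltn_ord k; have := ltn_ord l; have := ltn_ord i.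
  by move=> *; rewrite /= !inordK; rewrite /unbump; lia.
exists n, (monotone_map sm), (simplex_map (monotone_map dm) (simplex_map f y)).
split=> //.
  move=> j; exists (inord (if (j <= i)%N then j : nat else j.+1)); apply/val_inj => /=.
  have := ltn_ord j; have := ltn_ord i => *.
  rewrite inordK inordK; case: ifP; rewrite /unbump; lia.
rewrite -!simplex_map_comp; apply: simplex_map_ext => k /=.
have kn := ltn_ord k; have iN := ltn_ord i.
have [ki|ki] := eqVneq (k : nat) i.+1.
  rewrite (_ : k = lift ord0 i); last by apply/val_inj; rewrite /= /bump/=; lia.
  rewrite -fi; congr (f _); apply/val_inj => /=.
  rewrite inordK /bump /unbump /=; lia.
congr (f _); apply/val_inj => /=; rewrite inordK /bump /unbump /=; lia.
Qed.

(* The uniqueness half of the Eilenberg-Zilber lemma. *)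
Lemma Eilenberg_Zilber q n m (f : {omorphism 'I_q.+1 -> 'I_n.+1})
    (g : {omorphism 'I_q.+1 -> 'I_m.+1}) (x : X n) (y : X m) :
  faces X n x -> faces X m y ->
  (forall j, exists i, f i = j) -> (forall j, exists i, g i = j) ->
  simplex_map f x = simplex_map g y ->
  existT X n x = existT X m y /\ forall i, f i = g i :> nat.
Proof.
move=> xnd ynd fs gs xy.
(* A section [s] of [f1] expresses [x1] through [y1]; since [x1] is nondegenerate, [g1 \o s] is
   injective. Injections both ways give [n = m], and then [g \o s] is the identity. Choosing [s]
   through [k] compares [f] and [g] at [k]. *)
have key n1 m1 (f1 : {omorphism 'I_q.+1 -> 'I_n1.+1})
    (g1 : {omorphism 'I_q.+1 -> 'I_m1.+1}) (x1 : X n1) (y1 : X m1) k :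
    faces X n1 x1 -> (forall j, exists i, f1 i = j) ->
    simplex_map f1 x1 = simplex_map g1 y1 ->
    exists s : {omorphism 'I_n1.+1 -> 'I_q.+1},
      [/\ injective (g1 \o s), x1 = simplex_map (g1 \o s) y1 & s (f1 k) = k].
  move=> x1nd f1s xy1; have [s [fs1 sk]] := surjection_section k f1s.
  have x1E : x1 = simplex_map (g1 \o s) y1.
    rewrite simplex_map_comp -xy1 -simplex_map_comp -[LHS]simplex_map_id.
    by apply: simplex_map_ext => j /=; rewrite fs1.
  exists s; split=> //; apply: contrapT => gs_ninj.
  by apply: (noninjective_degenerate (y := y1) gs_ninj); rewrite -x1E.
have [s [si _ _]] := key _ _ _ _ _ _ ord0 xnd fs xy.
have [s' [s'i _ _]] := key _ _ _ _ _ _ ord0 ynd gs (esym xy).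
have nm : n = m.
  have := leq_card _ si; have := leq_card _ s'i; rewrite !card_ord !ltnS => *.
  by apply/eqP; rewrite eqn_leq; apply/andP.
subst m; split.
  have [s1 [s1i -> _]] := key _ _ _ _ _ _ ord0 xnd fs xy.
  rewrite (@simplex_map_ext _ _ _ idfun) ?simplex_map_id//.
  by apply: monotone_injective_id s1i; exact: (@omorphism_homo _ _ (g \o s1)).
move=> i; have [s1 [s1i _ s1k]] := key _ _ _ _ _ _ i xnd fs xy.
have := @monotone_injective_id _ _ (@omorphism_homo _ _ (g \o s1)) s1i (f i).
by rewrite /= s1k => ->.
Qed.

End Degeneracy.

(** * Points of a simplex as partitions of the unit interval *)

Section PartialSums.
Variable R : realType.

(** The coordinates of [t] are the lengths of consecutive intervals that partition [0, 1]; this is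
    the left end of the [k]-th one. *)
Definition partial_bc n (t : stdsimplex R n) (k : nat) : R :=
  \sum_(i < n.+1 | (i < k)%N) bc t i.

Lemma partial_bc0 n (t : stdsimplex R n) : partial_bc t 0 = 0.
Proof. by rewrite /partial_bc big_pred0. Qed.

Lemma partial_bc_le n (t : stdsimplex R n) k l :
  (k <= l)%N -> partial_bc t k <= partial_bc t l.
Proof.
move=> kl; rewrite /partial_bc [leRHS](bigID (fun i : 'I__ => (i < k)%N))/=.
rewrite [X in _ <= X + _](eq_bigl (fun i : 'I_n.+1 => (i < k)%N)).
  by rewrite lerDl sumr_ge0// => i _; exact: bc_ge0.
by move=> i /=; case: (ltnP i k) => ik; rewrite ?andbF// andbT (leq_trans ik).
Qed.

Lemma partial_bcS n (t : stdsimplex R n) (i : 'I_n.+1) :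
  partial_bc t i.+1 = partial_bc t i + bc t i.
Proof.
rewrite /partial_bc (bigD1 i)//= addrC; congr (_ + _); apply: eq_bigl => j.
by rewrite ltnS ltn_neqAle andbC.
Qed.

Lemma partial_bc_all n (t : stdsimplex R n) : partial_bc t n.+1 = 1.
Proof. by rewrite -(bc_sum t); apply: eq_bigl => i; rewrite ltn_ord. Qed.

Lemma partial_bc_ge0 n (t : stdsimplex R n) k : 0 <= partial_bc t k.
Proof. by rewrite -(partial_bc0 t) partial_bc_le. Qed.

Lemma partial_bc_le1 n (t : stdsimplex R n) k : partial_bc t k <= 1.
Proof.
rewrite -(bc_sum t) /partial_bc [leRHS](bigID (fun i : 'I__ => (i < k)%N))/=.
by rewrite lerDl sumr_ge0// => i _; exact: bc_ge0.
Qed.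

Lemma partial_bc_lt n (t : stdsimplex R n) k l :
  partial_bc t k < partial_bc t l -> (k < l)%N.
Proof. by move=> tkl; rewrite ltnNge; apply/negP => /(partial_bc_le t); lra. Qed.

Lemma partial_bc_push m n (f : 'I_m.+1 -> 'I_n.+1) (t : stdsimplex R m) k :
  partial_bc (push f t) k = \sum_(i | (f i < k)%N) bc t i.
Proof.
rewrite [RHS](partition_big f (fun j => (j < k)%N))//=; apply: eq_bigr => j jk.
rewrite bc_push; apply: eq_bigl => i.
by case: eqP => [->|]; rewrite ?andbF// jk.
Qed.

Lemma telescope_partial_bc n (t : stdsimplex R n) (P : R -> R) :
  \sum_(i < n.+1) (P (partial_bc t i.+1) - P (partial_bc t i)) = P 1 - P 0.
Proof.
rewrite -(big_mkord xpredT (fun i => P (partial_bc t i.+1) - P (partial_bc t i))).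
by rewrite telescope_sumr// partial_bc0 partial_bc_all.
Qed.

(* The length of the intersection of the i-th interval of t and the j-th of u. *)
Definition overlap p m (t : stdsimplex R p) (u : stdsimplex R m) i j : R :=
  clamp (partial_bc t i) (partial_bc t i.+1) (partial_bc u j.+1) -
  clamp (partial_bc t i) (partial_bc t i.+1) (partial_bc u j).

(** Both sides are the length of the intersection of [x, x'] and [y, y']. *)
Lemma clampBC (x x' y y' : R) : x <= x' -> y <= y' ->
  clamp x x' y' - clamp x x' y = clamp y y' x' - clamp y y' x.
Proof.
move=> xx' yy'; rewrite /clamp.
case: (leP x' y') => ?; case: (leP x' y) => ?; case: (leP x y) => ?;
  case: (leP x y') => ?; rewrite ?(max_r xx') ?(max_r yy'); try lra;
  case: (leP y x) => ?; lra.
Qed.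

Lemma clamp_le (x x' y y' : R) : y <= y' -> clamp x x' y <= clamp x x' y'.
Proof.
move=> yy'; rewrite /clamp ge_max !le_max lexx/=; apply/orP; right.
by rewrite le_min !ge_min lexx/= yy' orbT.
Qed.

Lemma clamp_lo (x x' y : R) : y <= x -> clamp x x' y = x.
Proof. by move=> yx; rewrite /clamp max_l// ge_min yx orbT. Qed.

Lemma clamp_hi (x x' y : R) : x <= x' -> x' <= y -> clamp x x' y = x'.
Proof. by move=> xx' x'y; rewrite /clamp min_l// max_r. Qed.

Lemma overlapC p m (t : stdsimplex R p) (u : stdsimplex R m) i j :
  overlap t u i j = overlap u t j i.
Proof. by apply: clampBC; exact: partial_bc_le. Qed.

Lemma overlap_ge0 p m (t : stdsimplex R p) (u : stdsimplex R m) i j :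
  0 <= overlap t u i j.
Proof. by rewrite subr_ge0 clamp_le// partial_bc_le. Qed.

Lemma overlap_sum p m (t : stdsimplex R p) (u : stdsimplex R m) (i : 'I_p.+1) :
  \sum_(j < m.+1) overlap t u i j = bc t i.
Proof.
rewrite telescope_partial_bc clamp_hi ?clamp_lo ?partial_bc_ge0 ?partial_bc_le1//.
  by rewrite partial_bcS addrC addKr.
exact: partial_bc_le.
Qed.

Lemma overlap_gt0 p m (t : stdsimplex R p) (u : stdsimplex R m) i j :
  0 < overlap t u i j -> partial_bc t i < partial_bc u j.+1.
Proof.
move=> w0; rewrite ltNge; apply/negP => ut; move: w0.
by rewrite /overlap !clamp_lo ?subrr ?ltxx// (le_trans _ ut)// partial_bc_le.
Qed.

(** If [f i < g j], the [i]-th interval of [t] ends no later than the interval [f i] of the common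
    image, hence before or where the [j]-th interval of [u] starts, which leaves no overlap. *)
Lemma overlap_fiber p m n (f : 'I_p.+1 -> 'I_n.+1) (g : 'I_m.+1 -> 'I_n.+1)
    (t : stdsimplex R p) (u : stdsimplex R m) (i : 'I_p.+1) (j : 'I_m.+1) :
  {homo f : i j / (i <= j)%N} -> {homo g : i j / (i <= j)%N} ->
  push f t = push g u -> 0 < overlap t u i j -> (g j <= f i)%N.
Proof.
move=> fm gm tu; rewrite overlapC => /overlap_gt0; apply: contraTT.
rewrite -ltnNge -leNgt => fg.
apply: (@le_trans _ _ (partial_bc (push f t) (f i).+1)).
  rewrite partial_bc_push [leRHS](bigID (fun k : 'I__ => (k <= i)%N))/=.
  rewrite /partial_bc [leLHS](eq_bigl (fun k : 'I_p.+1 => (f k < (f i).+1)%N && (k <= i)%N)).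
    by rewrite lerDl sumr_ge0// => k _; exact: bc_ge0.
  by move=> k; rewrite !ltnS; case: (leqP k i) => ki; rewrite ?andbF// fm.
rewrite tu partial_bc_push [leRHS](bigID (fun k : 'I__ => (g k < (f i).+1)%N))/=.
rewrite [X in _ <= X + _](eq_bigl (fun k : 'I_m.+1 => (g k < (f i).+1)%N)).
  by rewrite lerDl sumr_ge0// => k _; exact: bc_ge0.
move=> k; case: (ltnP k j) => //= jk; apply/esym/negbTE; rewrite -leqNgt.
by rewrite (leq_trans fg)// gm.
Qed.

(* The overlap weights are carried by a chain of the product order. *)
Lemma monotone_coupling p m (t : stdsimplex R p) (u : stdsimplex R m) :
  exists q (f : {omorphism 'I_q.+1 -> 'I_p.+1}) (g : {omorphism 'I_q.+1 -> 'I_m.+1})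
    (v : stdsimplex R q),
    [/\ push f v = t, push g v = u & forall k, 0 < overlap t u (f k) (g k)].
Proof.
pose w (ij : 'I_p.+1 * 'I_m.+1) := overlap t u ij.1 ij.2.
pose key (ij : 'I_p.+1 * 'I_m.+1) := (ij.1 + ij.2)%N.
(* The pairs of positive overlap are the pieces of the common refinement; sorting by [key] lists
   them from left to right. *)
pose L := sort (relpre key leq) [seq ij <- enum {: 'I_p.+1 * 'I_m.+1} | 0 < w ij].
have w0 ij : 0 <= w ij by exact: overlap_ge0.
have sumL (P : pred ('I_p.+1 * 'I_m.+1)) :
    \sum_(ij <- L | P ij) w ij = \sum_(ij | P ij) w ij.
  rewrite (perm_big _ (permEl (perm_sort _ _)))/= big_filter_cond/= big_enum_cond/=.
  rewrite [RHS](bigID (fun ij => 0 < w ij))/= [X in _ = _ + X]big1.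
    by rewrite addr0; apply: eq_bigl => ij; rewrite andbC.
  by move=> ij /andP[_]; rewrite lt_neqAle w0 andbT negbK => /eqP.
have row (P : pred 'I_p.+1) : \sum_(ij | P ij.1) w ij = \sum_(i | P i) bc t i.
  rewrite (eq_bigl (fun ij => P ij.1 && true)); last by move=> ij; rewrite andbT.
  rewrite -(pair_big P xpredT (fun (i : 'I_p.+1) (j : 'I_m.+1) => overlap t u i j))/=.
  by apply: eq_bigr => i _; rewrite overlap_sum.
have col (P : pred 'I_m.+1) : \sum_(ij | P ij.2) w ij = \sum_(j | P j) bc u j.
  rewrite (eq_bigl (fun ij => true && P ij.2))//.
  rewrite -(pair_big xpredT P (fun (i : 'I_p.+1) (j : 'I_m.+1) => overlap t u i j))/=.
  rewrite (exchange_big_dep P)//=; apply: eq_bigr => j Pj.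
  rewrite -(overlap_sum u t j); apply: eq_big => [i|i _]; first by rewrite Pj.
  exact: overlapC.
have sumL1 : \sum_(ij <- L) w ij = 1.
  by rewrite (sumL xpredT) (row xpredT) bc_sum.
have Lpos : (0 < size L)%N.
  by case: (L) sumL1 => //; rewrite big_nil => /esym/eqP; rewrite oner_eq0.
have wL ij : ij \in L -> 0 < w ij by rewrite mem_sort mem_filter => /andP[].
(* With the first index smaller in [ij] and the second smaller in [ij'], four ends of intervals
   would be cyclically ordered, with strict inequalities from the positive overlaps. The opposite
   inversion is symmetric, and ties in one index are settled by [key]. *)
have chain ij ij' : 0 < w ij -> 0 < w ij' -> (key ij <= key ij')%N ->
    (ij.1 <= ij'.1)%N /\ (ij.2 <= ij'.2)%N.
  move=> wij wij'; rewrite /key.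
  have := overlap_gt0 wij; have := overlap_gt0 wij'.
  have : 0 < overlap u t ij.2 ij.1 by rewrite overlapC.
  have : 0 < overlap u t ij'.2 ij'.1 by rewrite overlapC.
  move=> /overlap_gt0 h1 /overlap_gt0 h2 h3 h4 kij.
  have [l1|l1] := leqP ij.1 ij'.1; have [l2|l2] := leqP ij.2 ij'.2 => //.
  - have := partial_bc_lt (le_lt_trans (partial_bc_le u l2) (lt_le_trans h2 _)).
    have [e|ne] := eqVneq (ij.1 : nat) ij'.1; first by move: l2 kij; rewrite e; lia.
    have l1' : (ij.1.+1 <= ij'.1)%N by rewrite ltn_neqAle ne l1.
    have := partial_bc_le t l1'; have := partial_bc_le u l2; lra.
  - have [e|ne] := eqVneq (ij.2 : nat) ij'.2; first by move: l1 kij; rewrite e; lia.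
    have l2' : (ij.2.+1 <= ij'.2)%N by rewrite ltn_neqAle ne l2.
    have := partial_bc_le u l2'; have := partial_bc_le t l1; lra.
  - by move: kij l1 l2; lia.
pose q := (size L).-1; have qE : q.+1 = size L by rewrite prednK.
pose z : 'I_p.+1 * 'I_m.+1 := (ord0, ord0).
pose e (k : 'I_q.+1) := nth z L k.
have eL k : e k \in L by rewrite mem_nth// -qE.
have esort (k l : 'I_q.+1) : (k <= l)%N -> (key (e k) <= key (e l))%N.
  move=> kl; have := @sorted_leq_nth _ (relpre key leq) _ _ z L _ k l.
  apply=> //; rewrite ?inE -?qE ?ltn_ord//.
  - by move=> a b c; exact: leq_trans.
  - by move=> a; exact: leqnn.
  - by apply: sort_sorted => a b; exact: leq_total.
have fm : {homo (fun k => (e k).1) : k l / (k <= l)%N}.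
  by move=> k l /esort; case/chain; rewrite ?wL.
have gm : {homo (fun k => (e k).2) : k l / (k <= l)%N}.
  by move=> k l /esort; case/chain; rewrite ?wL.
have sume (P : pred ('I_p.+1 * 'I_m.+1)) :
    \sum_(k | P (e k)) w (e k) = \sum_(ij | P ij) w ij.
  by rewrite -sumL (big_nth z) big_mkord -qE.
have vP : (forall k, 0 <= w (e k)) /\ \sum_k w (e k) = 1.
  by split=> [k|]; rewrite ?w0// (sume xpredT) (row xpredT) bc_sum.
exists q, (monotone_map fm), (monotone_map gm), (mksimplex vP); split.
- apply: bc_inj => i; rewrite bc_push; under eq_bigr do rewrite bc_mksimplex.
  by rewrite (sume (fun ij => ij.1 == i)) (row (pred1 i)) big_pred1_eq.
- apply: bc_inj => j; rewrite bc_push; under eq_bigr do rewrite bc_mksimplex.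
  by rewrite (sume (fun ij => ij.2 == j)) (col (pred1 j)) big_pred1_eq.
- by move=> k; exact: wL.
Qed.

End PartialSums.

(** * Normal forms in the realization *)

(** By proof irrelevance, the induced equality [a = a] is [erefl], so the transport along it is
    trivial. *)
Lemma existT_inj (A : Type) (P : A -> Type) a (u v : P a) :
  existT P a u = existT P a v -> u = v.
Proof.
move=> E.
have H (s : sigT P) (e : existT P a u = s) :
    eq_rect a P u _ (f_equal (@projT1 _ _) e) = projT2 s by case: _ / e.
have := H _ E; set e := f_equal _ _.
by rewrite (Prop_irrelevance e erefl).
Qed.

Section NormalForm.
Variables (R : realType) (X : simplicial_set).
Local Notation RX := (realization R X).
Local Notation cells := (cells R X).
Local Notation char := (characteristic_map R).

Definition cell_simplex (c : cells) : X (projT1 (projT1 c)) := projT2 (projT1 c).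
Definition cell_point (c : cells) : stdsimplex R (projT1 (projT1 c)) := projT2 c.

Lemma cellE (c : cells) : c = cell (cell_simplex c) (cell_point c).
Proof. by case: c => -[n x] t. Qed.

Lemma cell_inj n (x : X n) (t u : stdsimplex R n) : cell x t = cell x u -> t = u.
Proof. by move=> E; exact: (existT_inj E). Qed.

(* Two cells connected by a common refinement; this turns out to be the
   equivalence relation generated by [glue]. *)
Definition linked n (x : X n) (t : stdsimplex R n) m (y : X m) (u : stdsimplex R m) :=
  exists q (f : {omorphism 'I_q.+1 -> 'I_n.+1}) (g : {omorphism 'I_q.+1 -> 'I_m.+1})
    (v : stdsimplex R q),
    [/\ simplex_map f x = simplex_map g y, push f v = t & push g v = u].

Lemma push_id n (t : stdsimplex R n) : push idfun t = t.
Proof. by apply: bc_inj => i; rewrite bc_push big_pred1_eq. Qed.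

Lemma push_push m n p (g : 'I_n.+1 -> 'I_p.+1) (f : 'I_m.+1 -> 'I_n.+1)
  (t : stdsimplex R m) : push g (push f t) = push (g \o f) t.
Proof. by rewrite -push_comp. Qed.

Lemma linked_refl n (x : X n) (t : stdsimplex R n) : linked x t x t.
Proof. by exists n, idfun, idfun, t; rewrite !push_id. Qed.

Lemma linked_sym n (x : X n) (t : stdsimplex R n) m (y : X m) (u : stdsimplex R m) :
  linked x t y u -> linked y u x t.
Proof. by move=> [q [f [g [v [? ? ?]]]]]; exists q, g, f, v. Qed.

(** The two refinements over [(y, u)] are refined jointly by [monotone_coupling]. Applying
    [overlap_fiber] in both directions shows that the two composites to [y] coincide. *)
Lemma linked_trans n (x : X n) (t : stdsimplex R n) m (y : X m) (u : stdsimplex R m)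
    p (z : X p) (w : stdsimplex R p) :
  linked x t y u -> linked y u z w -> linked x t z w.
Proof.
move=> [q [f [g [v [fg ft gu]]]]] [q' [f' [g' [v' [fg' ft' gu']]]]].
have [r [h [h' [r0 [hr h'r pos]]]]] := monotone_coupling v v'.
exists r, (f \o h), (g' \o h'), r0; split; last 2 first.
- by rewrite -push_push hr.
- by rewrite -push_push h'r.
rewrite simplex_map_comp fg simplex_map_comp -fg' -!simplex_map_comp.
apply: simplex_map_ext => k /=; apply/val_inj/eqP.
have gm := @omorphism_homo _ _ g; have fm := @omorphism_homo _ _ f'.
have pos' : 0 < overlap v' v (h' k) (h k) by rewrite overlapC.
have gf : push g v = push f' v' by rewrite gu ft'.
by rewrite eqn_leq (overlap_fiber fm gm (esym gf) pos') (overlap_fiber gm fm gf (pos k)).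
Qed.

Lemma linked_glue n (x : X n) (t : stdsimplex R n) m (y : X m) (u : stdsimplex R m) :
  linked x t y u <->
  Relation_Operators.clos_refl_sym_trans _ (@Defs.glue R X) (cell x t) (cell y u).
Proof.
split=> [[q [f [g [v [fg <- <-]]]]]|].
  apply: (Relation_Operators.rst_trans _ _ _ (cell (simplex_map f x) v)).
    by apply: Relation_Operators.rst_sym; apply: Relation_Operators.rst_step.
  by rewrite fg; apply: Relation_Operators.rst_step.
suff H c c' : Relation_Operators.clos_refl_sym_trans _ (@Defs.glue R X) c c' ->
    linked (cell_simplex c) (cell_point c) (cell_simplex c') (cell_point c').
  exact: (H (cell x t) (cell y u)).
elim=> [_ _ [m' n' f z v]|d|d d' _|d d' d'' _ IH _].
- by exists m', idfun, f, v; rewrite simplex_map_id push_id.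
- exact: linked_refl.
- exact: linked_sym.
- exact: linked_trans IH.
Qed.

Lemma characteristic_mapP n (x : X n) (t : stdsimplex R n) m (y : X m)
    (u : stdsimplex R m) :
  char x t = char y u <-> linked x t y u.
Proof.
rewrite linked_glue; pose e := @eqquotP _ _ {eq_quot @Defs.glue_eq R X} (cell x t) (cell y u).
split=> [H|H]; last by apply/e/asboolP.
by have /e/asboolP := H.
Qed.

Lemma characteristic_map_push m n (f : {omorphism 'I_m.+1 -> 'I_n.+1}) (x : X n)
    (t : stdsimplex R m) :
  char (simplex_map f x) t = char x (push f t).
Proof. by apply/characteristic_mapP; exists m, idfun, f, t; rewrite simplex_map_id push_id. Qed.

Lemma realization_cell (p : RX) : exists n (x : X n) t, p = char x t.
Proof.
exists _, (cell_simplex (repr p)), (cell_point (repr p)).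
by rewrite /characteristic_map -cellE reprK.
Qed.

Definition inner n (t : stdsimplex R n) := forall i, 0 < bc t i.

Definition normal (c : cells) := faces X _ (cell_simplex c) /\ inner (cell_point c).

Lemma inner_push_surj m n (f : 'I_m.+1 -> 'I_n.+1) (t : stdsimplex R m) :
  inner (push f t) -> forall j, exists i, f i = j.
Proof.
move=> H j; apply: contrapT => nfj; have := H j; rewrite bc_push big_pred0 ?ltxx//.
by move=> i; apply/negbTE/eqP => fij; apply: nfj; exists i.
Qed.

(** As [t] and [u] are interior, both operators of a link are surjective; [Eilenberg_Zilber] then
    identifies the simplices and the operators. *)
Lemma normal_unique n (x : X n) (t : stdsimplex R n) m (y : X m) (u : stdsimplex R m) :
  normal (cell x t) -> normal (cell y u) -> char x t = char y u -> cell x t = cell y u.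
Proof.
move=> [/= xnd ti] [/= ynd ui] /characteristic_mapP[q [f [g [v [fg ft gu]]]]].
have fs : forall j, exists i, f i = j by apply: (@inner_push_surj _ _ _ v); rewrite ft.
have gs : forall j, exists i, g i = j by apply: (@inner_push_surj _ _ _ v); rewrite gu.
have [xy fgE] := Eilenberg_Zilber xnd ynd fs gs fg.
have nm : n = m := f_equal (@projT1 _ _) xy.
subst m; have {}xy : x = y := existT_inj xy; subst y.
have fg' : f = g by apply: omorphism_ext => i; apply/val_inj/fgE.
by rewrite -ft -gu fg'.
Qed.

(** The retraction onto the facet takes the default value [ord0] at [i], which is harmless because
    the weight there is [bc t i = 0]. *)
Lemma zero_coordinate n (t : stdsimplex R n.+1) (i : 'I_n.+2) : bc t i = 0 ->
  t = push (lift i) (push (fun k => odflt ord0 (unlift i k)) t).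
Proof.
move=> ti0; apply: bc_inj => j; rewrite push_push bc_push.
rewrite [RHS](bigID (pred1 i))/= big1 ?add0r; last first.
  by move=> k /andP[_ /eqP->].
have [->|ji] := eqVneq j i.
  rewrite ti0 big_pred0// => k; apply/negbTE/negP => /andP[/eqP E _].
  by have := neq_lift i (odflt ord0 (unlift i k)); rewrite E eqxx.
rewrite (big_pred1 j)// => k; have [-> /=|ki] := eqVneq k i.
  by rewrite andbF eq_sym (negbTE ji).
by case: unliftP ki => [l ->|->]; rewrite ?eqxx//= andbT.
Qed.

Lemma lift_homo n (i : 'I_n.+2) : {homo lift i : k l / (k <= l)%N}.
Proof. by move=> k l kl /=; rewrite leq_bump2. Qed.

Definition face n (i : 'I_n.+2) (x : X n.+1) : X n :=
  simplex_map (monotone_map (@lift_homo n i)) x.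

Lemma char_face n (i : 'I_n.+2) (x : X n.+1) (t : stdsimplex R n) :
  char (face i x) t = char x (push (lift i) t).
Proof. exact: characteristic_map_push. Qed.

Lemma innerPn n (t : stdsimplex R n) : ~ inner t -> exists i, bc t i = 0.
Proof.
move=> /existsNP[i /negP]; rewrite lt_neqAle bc_ge0 andbT negbK => /eqP ti.
by exists i.
Qed.

(** By induction on dimension: a degenerate simplex is replaced by one that it comes from, a
    boundary point by a point of a facet. The last clause records that the dimension drops as soon
    as a replacement is made, as [cell_dim_boundary] requires. *)
Lemma normal_exists n (x : X n) (t : stdsimplex R n) :
  exists c, [/\ normal c, char (cell_simplex c) (cell_point c) = char x t,
    (projT1 (projT1 c) <= n)%N & (normal (cell x t) \/ (projT1 (projT1 c) < n)%N)].
Proof.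
elim/ltn_ind: n x t => n IH x t.
have [nxt|nnxt] := pselect (normal (cell x t)).
  by exists (cell x t); split=> //; left.
have reduce m (y : X m) u : (m < n)%N -> char x t = char y u ->
    exists c, [/\ normal c, char (cell_simplex c) (cell_point c) = char x t,
    (projT1 (projT1 c) <= n)%N & (normal (cell x t) \/ (projT1 (projT1 c) < n)%N)].
  move=> mn ->; have [c [cn cE cm _]] := IH m mn y u.
  by exists c; split=> //; [rewrite ltnW// (leq_ltn_trans cm)|right; exact: leq_ltn_trans mn].
have [xnd|/contrapT[m [f [y [mn fs xE]]]]] := pselect (faces X n x); last first.
  by apply: (reduce _ y (push f t)) => //; rewrite xE characteristic_map_push.
have [ti|/innerPn[i ti0]] := pselect (inner t); first by case: nnxt.
case: n x t IH nnxt reduce xnd i ti0 => [|n] x t IH nnxt reduce xnd i ti0.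
  by have := bc_sum t; rewrite big_ord1 -[X in bc t X](ord1 i) ti0 => /esym/eqP; rewrite oner_eq0.
apply: (reduce n (face i x) (push (fun k => odflt ord0 (unlift i k)) t)) => //.
by rewrite char_face -zero_coordinate.
Qed.

Lemma normal_form_exists (p : RX) :
  exists c, normal c /\ p = char (cell_simplex c) (cell_point c).
Proof.
have [n [x [t ->]]] := realization_cell p.
by have [c [cn cE _ _]] := normal_exists x t; exists c.
Qed.

Definition normal_form (p : RX) : cells := projT1 (cid (normal_form_exists p)).

Lemma normal_form_normal p : normal (normal_form p).
Proof. by rewrite /normal_form; case: cid => c []. Qed.

Lemma normal_formK p : char (cell_simplex (normal_form p)) (cell_point (normal_form p)) = p.
Proof. by rewrite /normal_form; case: cid => c []. Qed.

Lemma normal_form_char n (x : X n) (t : stdsimplex R n) :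
  normal (cell x t) -> normal_form (char x t) = cell x t.
Proof.
move=> xt; rewrite (cellE (normal_form _)); apply: normal_unique => //.
  by rewrite -cellE; exact: normal_form_normal.
exact: normal_formK.
Qed.

Definition cell_dim (p : RX) : nat := projT1 (projT1 (normal_form p)).

Lemma cell_dim_char n (x : X n) (t : stdsimplex R n) : (cell_dim (char x t) <= n)%N.
Proof.
have [c [cn cE cm _]] := normal_exists x t.
by rewrite /cell_dim -cE normal_form_char -cellE.
Qed.

Lemma cell_dim_boundary n (x : X n) (t : stdsimplex R n) :
  ~ inner t -> (cell_dim (char x t) < n)%N.
Proof.
have [c [cn cE cm cn']] := normal_exists x t => nt.
case: cn' => [[]//|]; by rewrite /cell_dim -cE normal_form_char -cellE.
Qed.

Lemma cell_dim_inner n (x : X n) (t : stdsimplex R n) :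
  faces X n x -> inner t -> cell_dim (char x t) = n.
Proof. by move=> *; rewrite /cell_dim normal_form_char. Qed.

Lemma closed_realizationP (C : set RX) :
  closed C <-> forall n (x : X n), closed (char x @^-1` C).
Proof.
have -> : closed C <-> open (~` C) by split=> [/closed_openC//|/open_closedC]; rewrite setCK.
have -> : open (~` C) <-> open (\pi_RX @^-1` ~` C) by [].
rewrite sigT_openP; split=> [H n x|H [n x]].
  by rewrite -[_ @^-1` _]setCK; apply: open_closedC; exact: (H (existT _ n x)).
by apply: closed_openC; exact: H.
Qed.

Lemma characteristic_map_continuous n (x : X n) : continuous (char x).
Proof.
apply/continuous_closedP => C /closed_realizationP; exact.
Qed.

(** The image consists of the fixed points of [push f \o push g] that [push g] sends into [D], and
    both conditions are closed. *)
Lemma closed_pushforward m n (f : 'I_m.+1 -> 'I_n.+1) (g : 'I_n.+1 -> 'I_m.+1)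
    (D : set (stdsimplex R m)) :
  cancel f g -> closed D -> closed (push f @` D).
Proof.
move=> fK cD.
have -> : push f @` D = [set t | push f (push g t) = t] `&` (push g @^-1` D).
  apply/seteqP; split=> [_ [t Dt <-]|t [/= tE Dt]]; last by exists (push g t).
  have gf : push g (push f t) = t.
    by rewrite push_push -[RHS]push_id; congr push; apply/funext => i /=; rewrite fK.
  by split=> /=; rewrite gf.
apply: closedI; last by apply: closed_comp => // t _; exact: push_continuous.
have -> : [set t : stdsimplex R n | push f (push g t) = t] =
    \bigcap_i ((fun t => bc (push f (push g t)) i - bc t i) @^-1` [set 0]).
  apply/seteqP; split=> [t /= tE i _|t /= H]; first by rewrite /= tE subrr.
  by apply: bc_inj => i; have /eqP := H i I; rewrite subr_eq0 => /eqP.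
apply: closed_bigI => i _; apply: closed_comp => [t _|]; last exact: closed_eq.
apply: ctsB; last exact: bc_continuous.
apply: cts_comp (@bc_continuous _ _ i); apply: cts_comp; exact: push_continuous.
Qed.

(* A set is closed as soon as it can be recognised on the open cells by closed
   conditions that never leave the set; no compactness is involved. *)
Lemma closed_by_cells (C : set RX) :
  (forall n (x : X n), faces X n x -> exists B : set (stdsimplex R n),
     [/\ closed B, forall t, B t -> C (char x t) &
         forall t, inner t -> C (char x t) -> B t]) ->
  closed C.
Proof.
move=> HC; apply/closed_realizationP => n; elim/ltn_ind: n => n IH x.
have [xnd|/contrapT[m [f [y [mn fs ->]]]]] := pselect (faces X n x); last first.
  have -> : char (simplex_map f y) @^-1` C = push f @^-1` (char y @^-1` C).
    by apply/seteqP; split=> t /=; rewrite characteristic_map_push.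
  by apply: closed_comp => [t _|]; [exact: push_continuous|exact: IH].
have [B [cB BC CB]] := HC n x xnd.
case: n x IH xnd B cB BC CB => [|n] x IH xnd B cB BC CB.
  suff -> : char x @^-1` C = B by [].
  apply/seteqP; split=> t; last exact: BC.
  apply: CB => i; rewrite (ord1 i); have := bc_sum t; rewrite big_ord1 => ->.
  exact: ltr01.
(* A point is either inner, where [B] decides, or on one of the finitely many facets, where the
   induction hypothesis applies. *)
have -> : char x @^-1` C =
    B `|` \bigcup_(i in [set: 'I_n.+2]) push (lift i) @` (char (face i x) @^-1` C).
  apply/seteqP; split=> [t /= Ct|t [/BC//|[i _ [u]]]]; last first.
    by rewrite /= char_face => Cu <-.
  have [ti|/innerPn[i ti0]] := pselect (inner t); first by left; exact: CB.
  right; exists i => //; rewrite [t](zero_coordinate ti0).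
  eexists; last by reflexivity.
  by rewrite /= char_face -zero_coordinate.
apply: closedU => //; apply: closed_bigcup; first exact: finite_finset.
move=> i _; apply: (@closed_pushforward _ _ _ (fun k => odflt ord0 (unlift i k))).
  by move=> k; rewrite liftK.
exact: IH.
Qed.

End NormalForm.

(** * Paths in the realization *)

Section PathTools.
Variable R : realType.

(** For fixed [u], the function [D u] is locally constant, and the line is connected. *)
Lemma locally_trivial (D : R -> R -> 'F_2) :
  (forall u v w, D u w = D u v + D v w) ->
  (forall u, \forall v \near u, D u v = 0) -> forall u v, D u v = 0.
Proof.
move=> DD Dloc u v.
have Duu w : D w w = 0 by have := DD w w w; move/eqP; rewrite -subr_eq0 opprD addNKr oppr_eq0 => /eqP.
suff : [set w | D u w = 0] = setT by move/seteqP => [_ /(_ v I)].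
have conn : connected [set: R] by apply/connected_intervalP.
have near_const w : \forall w' \near w, D u w' = D u w.
  by have := Dloc w; apply: filterS => w' ww'; rewrite (DD u w w') ww' addr0.
apply: conn; first by exists u; exact: Duu.
- exists [set w | D u w = 0]; last by rewrite setTI.
  rewrite openE => w /= uw; have := near_const w; apply: filterS => w'.
  by rewrite /= uw.
- exists [set w | D u w = 0]; last by rewrite setTI.
  rewrite -[X in closed X]setCK; apply: open_closedC.
  rewrite openE => w /= uw; have := near_const w; apply: filterS => w'.
  by rewrite /= => ->.
Qed.

Variables (Y : topologicalType) (a : cochain R 'F_2 Y 1).

Lemma path_holonomy_ext (g g' : R -> Y) u v :
  (forall s, 0 <= s <= 1 -> g ((1 - s) * u + s * v) = g' ((1 - s) * u + s * v)) ->
  path_holonomy a g u v = path_holonomy a g' u v.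
Proof.
move=> gg'; congr ev; apply/funext => t; rewrite /segment/=.
have -> : bc t ord0 = 1 - bc t ord_max by rewrite -(bc1D t) addrK.
by apply: gg'; rewrite bc_ge0 bc_le1.
Qed.

Lemma path_holonomy_reparam (g : R -> Y) u v :
  path_holonomy a (fun s => g ((1 - s) * u + s * v)) 0 1 = path_holonomy a g u v.
Proof.
congr ev; apply/funext => t; rewrite /segment/=.
have -> : bc t ord0 = 1 - bc t ord_max by rewrite -(bc1D t) addrK.
by rewrite mulr0 mulr1 add0r.
Qed.

(** [k] retracts the line onto a short interval around [u]. Composing a path with it turns what
    holds near [u] into what holds at all times, and keeps the holonomy near [u]. *)
Lemma localize (u : R) (Q : R -> Prop) : (\forall r \near u, Q r) ->
  exists k : R -> R, [/\ continuous k, forall r, Q (k r), k u = u &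
    \forall v \near u, k v = v /\
      forall g : R -> Y, path_holonomy a g u v = path_holonomy a (g \o k) u v].
Proof.
move=> /nbhs_ballP[d /= d0 dQ].
have d20 : 0 < d / 2 by rewrite divr_gt0.
have uu : u - d / 2 <= u + d / 2 by lra.
exists (clamp (u - d / 2) (u + d / 2)); split.
- exact: clamp_continuous.
- move=> r; apply: dQ; rewrite /ball/= ltr_distlC.
  by have := clamp_itv r uu; lra.
- by apply: clamp_id; lra.
- apply/nbhs_ballP; exists (d / 2) => //= v; rewrite /ball/= ltr_distlC => uv.
  split=> [|g]; first by apply: clamp_id; lra.
  apply: path_holonomy_ext => s s01 /=; rewrite clamp_id//.
  have -> : (1 - s) * u + s * v = u + s * (v - u) by ring.
  by apply/andP; split; nra.
Qed.

End PathTools.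

(** * Radial deformation of cells and continuity of its tracks *)

Section PushOff.
Variable R : realType.

(** The least coordinate, truncated at half of its value at the barycentre. The truncation keeps the
    denominator in [push_off] at least one half. *)
Definition depth n (t : stdsimplex R n) : R :=
  \big[Num.min/ (2 * n.+1%:R)^-1]_(i < n.+1) bc t i.

Lemma depth_continuous n : continuous (@depth n).
Proof.
rewrite /depth; elim: (index_enum _) => [|i s IH].
  under eq_fun do rewrite big_nil; exact: cts_cst.
under eq_fun do rewrite big_cons; apply: cts_min => //; exact: bc_continuous.
Qed.

Lemma depth_le n (t : stdsimplex R n) i : depth t <= bc t i.
Proof. by rewrite /depth (bigD1 i)//= ge_min lexx. Qed.

Lemma depth_bound n (t : stdsimplex R n) : depth t * n.+1%:R <= 2^-1.
Proof.
rewrite -ler_pdivlMr ?ltr0n// -invfM /depth.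
elim: (index_enum _) => [|i s IH]; first by rewrite big_nil.
by rewrite big_cons ge_min IH orbT.
Qed.

Lemma depth_ge0 n (t : stdsimplex R n) : 0 <= depth t.
Proof.
rewrite /depth; elim: (index_enum _) => [|i s IH].
  by rewrite big_nil invr_ge0 mulr_ge0.
by rewrite big_cons le_min bc_ge0.
Qed.

Lemma depth_attained n (t : stdsimplex R n) i :
  bc t i < (2 * n.+1%:R)^-1 -> exists j, depth t = bc t j.
Proof.
move=> ti; apply: contrapT => nattained.
have := depth_le t i; suff -> : depth t = (2 * n.+1%:R)^-1 by rewrite leNgt ti.
have : depth t = (2 * n.+1%:R)^-1 \/ exists j, depth t = bc t j.
  rewrite /depth; elim: (index_enum _) => [|j s IH]; first by left; rewrite big_nil.
  rewrite big_cons; case: leP => _; last exact: IH.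
  by right; exists j.
by case.
Qed.

Lemma push_off_subproof n (t : stdsimplex R n) (r : R)
    (m := clamp 0 1 r * depth t) :
  (forall i, 0 <= (bc t i - m) / (1 - n.+1%:R * m)) /\
  \sum_i (bc t i - m) / (1 - n.+1%:R * m) = 1.
Proof.
have /andP[c0 c1] := clamp_itv r (@ler01 R).
have m_le : m <= depth t by rewrite /m ler_piMl// depth_ge0.
have den : n.+1%:R * m <= 2^-1.
  by rewrite mulrC (le_trans _ (depth_bound t))// ler_wpM2r.
have den0 : 0 < 1 - n.+1%:R * m by lra.
split=> [i|].
  by rewrite divr_ge0 ?(ltW den0)// subr_ge0 (le_trans m_le)// depth_le.
rewrite -big_distrl/= sumrB bc_sum sumr_const card_ord -[X in _ - X]mulr_natl.
by rewrite divff// gt_eqF.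
Qed.

(* Moves t away from the barycentre; at time 1 it reaches the boundary, unless t is
   close to the barycentre. The boundary is fixed. *)
Definition push_off n (t : stdsimplex R n) (r : R) : stdsimplex R n :=
  mksimplex (push_off_subproof t r).

Lemma push_off_continuous n :
  continuous (fun p : stdsimplex R n * R => push_off p.1 p.2).
Proof.
apply: continuous_bc => i; under eq_fun do rewrite bc_mksimplex.
have cm : continuous (fun p : stdsimplex R n * R => clamp 0 1 p.2 * depth p.1).
  apply: ctsM.
    by apply: cts_comp (@clamp_continuous R 0 1); apply: cts_snd; exact: cts_id.
  by apply: cts_comp (@depth_continuous n); apply: cts_fst; exact: cts_id.
apply: ctsM.
  apply: ctsB => //; apply: cts_comp (@bc_continuous _ _ i).
  by apply: cts_fst; exact: cts_id.
apply: ctsV => [p|]; last by apply: ctsB; [exact: cts_cst|apply: ctsM => //; exact: cts_cst].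
rewrite gt_eqF// subr_gt0.
have /andP[c0 c1] := clamp_itv p.2 (@ler01 R).
rewrite mulrC (@le_lt_trans _ _ (depth p.1 * n.+1%:R))//.
  by rewrite ler_wpM2r// ler_piMl// depth_ge0.
by rewrite (le_lt_trans (depth_bound _))// invf_lt1 ?ltr1n.
Qed.

Lemma push_off0 n (t : stdsimplex R n) : push_off t 0 = t.
Proof.
apply: bc_inj => i; rewrite bc_mksimplex clamp_id ?lexx ?ler01//.
by rewrite mul0r mulr0 !subr0 divr1.
Qed.

Lemma push_off_boundary n (t : stdsimplex R n) r :
  ~ inner t -> push_off t r = t.
Proof.
move=> /innerPn[i ti0]; apply: bc_inj => j; rewrite bc_mksimplex.
have -> : depth t = 0 by apply/eqP; rewrite eq_le depth_ge0 -ti0 depth_le.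
by rewrite !mulr0 !subr0 divr1.
Qed.

Lemma push_off1 n (t : stdsimplex R n) i :
  bc t i < (2 * n.+1%:R)^-1 -> ~ inner (push_off t 1).
Proof.
move=> /depth_attained[j tj] /(_ j).
by rewrite bc_mksimplex clamp_id ?lexx ?ler01// mul1r tj subrr mul0r ltxx.
Qed.

Lemma push_off_clamp n (t : stdsimplex R n) r :
  push_off t r = push_off t (clamp 0 1 r).
Proof.
apply: bc_inj => j; rewrite !bc_mksimplex.
by rewrite (@clamp_id _ _ _ (clamp 0 1 r))// clamp_itv.
Qed.

End PushOff.

Section SmallPaths.
Variables (R : realType) (X : simplicial_set).
Local Notation RX := (realization R X).
Local Notation char := (characteristic_map R).

Lemma closed_simplex_point n (t : stdsimplex R n) : closed [set t].
Proof.
have -> : [set t] = \bigcap_i ((fun u => bc u i) @^-1` [set bc t i]).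
  apply/seteqP; split=> [u -> //|u H].
  by apply: bc_inj => i; exact: (H i I).
apply: closed_bigI => i _; apply: closed_comp => [u _|]; last exact: closed_eq.
exact: bc_continuous.
Qed.

Lemma closed_bc_ge n (i : 'I_n.+1) (e : R) : closed [set t : stdsimplex R n | e <= bc t i].
Proof.
apply: (@closed_comp _ _ (fun t => bc t i) [set r | e <= r]) => [u _|].
  exact: bc_continuous.
exact: closed_ge.
Qed.

Lemma closed_bc_le n (i : 'I_n.+1) (e : R) : closed [set t : stdsimplex R n | bc t i <= e].
Proof.
apply: (@closed_comp _ _ (fun t => bc t i) [set r | r <= e]) => [u _|].
  exact: bc_continuous.
exact: closed_le.
Qed.

(* Only finitely many of the points approaching g u can lie in cells of a given
   dimension, so they would form a closed set. *)
Lemma locally_bounded_dim (g : R -> RX) (u : R) : continuous g ->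
  exists N, \forall r \near u, (cell_dim (g r) < N)%N.
Proof.
move=> cg; apply: contrapT => /forallNP H.
(* Times tending to [u] along which the dimension outgrows both the index and [cell_dim (g u)]; the
   latter keeps [g u] out of [D]. *)
have /choice[r Hr] : forall k, exists r : R,
    `|u - r| < k.+1%:R^-1 /\ (k + (cell_dim (g u)).+1 <= cell_dim (g r))%N.
  move=> k; apply: contrapT => /forallNP nr; apply: (H (k + (cell_dim (g u)).+1)%N).
  apply/nbhs_ballP; exists k.+1%:R^-1 => /=; first by rewrite invr_gt0 ltr0n.
  move=> r ur; rewrite ltnNge; apply/negP => kr; apply: (nr r); split=> //.
pose D : set RX := [set g (r k) | k in [set: nat]].
have cD : closed D.
  apply: closed_by_cells => n y ynd.
  (* An open cell of dimension [n] contains [g (r k)] only for [k <= n], so it meets [D] in finitely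
     many points. *)
  exists (\bigcup_(k in `I_n.+1) [set t | inner t /\ g (r k) = char y t]); split.
  - apply: closed_bigcup; first exact: finite_II.
    move=> k _; have [[t0 [t0i gt0]]|nt] :=
      pselect (exists t, inner t /\ g (r k) = char y t); last first.
      suff -> : [set t | inner t /\ g (r k) = char y t] = set0 by exact: closed0.
      by apply/seteqP; split=> t //= ?; apply: nt; exists t.
    suff -> : [set t | inner t /\ g (r k) = char y t] = [set t0].
      exact: closed_simplex_point.
    apply/seteqP; split=> [t /= [ti gt]|t -> //].
    by apply: (@cell_inj _ _ _ y); apply: normal_unique; [by split|by split|by rewrite -gt0 -gt].
  - by move=> t [k _ [_ <-]]; exists k.
  - move=> t ti [k _ gk]; exists k => //=; have [_ ] := Hr k.
    rewrite gk cell_dim_inner//; lia.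
have ugD : ~ D (g u) by move=> [k _ gk]; have [_] := Hr k; rewrite gk; lia.
have /nbhs_ballP[d /= d0 dD] : \forall v \near u, ~ D (g v).
  by apply: (cg u (~` D)); apply: open_nbhs_nbhs; split=> //; exact: closed_openC.
have [k kd] : exists k, k.+1%:R^-1 < d.
  by have [k _ /(_ k (leqnn _))] := @near_infty_natSinv_lt R (PosNum d0); exists k.
apply: (dD (r k)); last by exists k.
by have [kr _] := Hr k; rewrite /ball/= (lt_trans kr).
Qed.

(* Radial deformation of the cells of dimension n away from their barycentres,
   relative to the cells of smaller dimension. *)
Definition radial n (q : RX) (r : R) : RX :=
  if (cell_dim q < n)%N then q
  else char (cell_simplex (normal_form q)) (push_off (cell_point (normal_form q)) r).

Lemma radial_char n (x : X n) (t : stdsimplex R n) r : faces X n x ->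
  radial n (char x t) r = char x (push_off t r).
Proof.
move=> xnd; have [ti|ti] := pselect (inner t); last first.
  by rewrite push_off_boundary// /radial cell_dim_boundary.
by rewrite /radial cell_dim_inner// ltnn normal_form_char.
Qed.

(** Each track stays in a single simplex, so that what is known for paths inside one cell applies to
    it. *)
Lemma radial_track n (q : RX) : exists m (x : X m) (c : R -> stdsimplex R m),
  continuous c /\ forall r, radial n q r = char x (c r).
Proof.
exists _, (cell_simplex (normal_form q)).
have [qn|qn] := boolP (cell_dim q < n)%N.
  exists (fun _ => cell_point (normal_form q)); split; first exact: cts_cst.
  by move=> r; rewrite /radial qn normal_formK.
exists (fun r => push_off (cell_point (normal_form q)) r).
split; last by move=> r; rewrite /radial (negbTE qn).
have cp := @push_off_continuous R (projT1 (projT1 (normal_form q))).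
apply: (cts_comp (f := fun r : R => (cell_point (normal_form q), r))) cp.
by apply: cts_pair; [exact: cts_cst|exact: cts_id].
Qed.

Lemma radial0 n q : radial n q 0 = q.
Proof. by rewrite /radial; case: ifP => // _; rewrite push_off0 normal_formK. Qed.

Lemma radial_clamp n q r : radial n q r = radial n q (clamp 0 1 r).
Proof. by rewrite /radial; case: ifP => // _; rewrite push_off_clamp. Qed.

(** In cells of dimension [n], the tube lemma for the compact set [J] applies. In lower cells the
    tracks are constant, and [r0] is a time at which to test them; higher cells are excluded by
    dimension. *)
Lemma radial_closed n (W : set RX) (J : set R) (r0 : R) : open W -> compact J -> J r0 ->
  closed [set q | (cell_dim q <= n)%N /\ exists2 r, J r & ~ W (radial n q r)].
Proof.
move=> oW cJ Jr0; apply: closed_by_cells => m y ynd.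
have [mn|nm|mn] := ltngtP m n.
- have radE t r : radial n (char y t) r = char y t.
    by rewrite /radial (leq_ltn_trans (cell_dim_char _ _)).
  exists (char y @^-1` (~` W)); split.
  + apply: closed_comp => [t _|]; first exact: characteristic_map_continuous.
    exact: open_closedC.
  + move=> t /= nW; split; first by rewrite (leq_trans (cell_dim_char _ _))// ltnW.
    by exists r0; rewrite ?radE.
  + by move=> t ti [_ [r _]]; rewrite radE.
- exists set0; split=> //; first exact: closed0.
  by move=> t ti [+ _]; rewrite cell_dim_inner// leqNgt nm.
subst m; exists [set t | exists2 r, J r & ~ W (char y (push_off t r))]; split.
- rewrite -[X in closed X]setCK; apply: open_closedC; rewrite openE => t /= tJ.
  have tW r : J r -> W (char y (push_off t r)).
    by move=> Jr; apply: contrapT => nW; apply: tJ; exists r.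
  have /compact_near_coveringP cov := cJ.
  suff uW : \forall u \near t, J `<=` (fun r => W (char y (push_off u r))).
    by apply: filterS uW => u uJ [r Jr]; apply; exact: uJ.
  apply: (cov _ (nbhs t) (fun u r => W (char y (push_off u r)))) => r Jr.
  have cc : continuous (fun p : stdsimplex R n * R => char y (push_off p.1 p.2)).
    by apply: cts_comp (@push_off_continuous R n) _; exact: characteristic_map_continuous.
  have /(cc (t, r)) : nbhs (char y (push_off t r)) W.
    by apply: open_nbhs_nbhs; split=> //; exact: tW.
  case=> -[A B] /= [tA rB] AB; exists (B, A); first by split.
  by move=> [r' u] [/= Br Au]; exact: (AB (u, r')).
- move=> t [r Jr nW]; split; first exact: cell_dim_char.
  by exists r; rewrite ?radial_char.
- by move=> t ti [_ [r Jr]]; rewrite radial_char// => nW; exists r.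
Qed.

(** The track from [g u] stays in [V] for times in a compact interval around [r]. By
    [radial_closed], so do the tracks from [g u'] for [u'] near [u]. *)
Lemma radial_continuous n (g : R -> RX) : continuous g ->
  (forall r, (cell_dim (g r) <= n)%N) ->
  continuous (fun p : R * R => radial n (g p.1) p.2).
Proof.
move=> cg gn; apply: continuous_prodP => u r V oV Vur.
have [m [x [c [cc trackE]]]] := radial_track n (g u).
have : nbhs r [set s | V (radial n (g u) s)].
  have cx : continuous (fun s => char x (c s)).
    by apply: cts_comp cc _; exact: characteristic_map_continuous.
  have : nbhs r ((fun s => char x (c s)) @^-1` V).
    by apply: cx; apply: open_nbhs_nbhs; split=> //; rewrite -trackE.
  by apply: filterS => s; rewrite /= trackE.
move=> /nbhs_ballP[d /= d0 dV].
have d20 : 0 < d / 2 by rewrite divr_gt0.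
have cJ := @segment_compact R (r - d / 2) (r + d / 2).
have Jr : `[r - d / 2, r + d / 2]%classic r by rewrite /= in_itv/=; lra.
have cK := radial_closed (n := n) oV cJ Jr.
pose A : set R := g @^-1` ~` [set q | (cell_dim q <= n)%N /\
    exists2 r0, `[r - d / 2, r + d / 2]%classic r0 & ~ V (radial n q r0)].
pose B : set R := ball r (d / 2).
have nA : nbhs u A.
  apply: cg; apply: open_nbhs_nbhs; split; first exact: closed_openC.
  move=> [_ [s]]; rewrite /= in_itv/= => rs; apply; apply: dV.
  by rewrite /ball/= ltr_distlC; lra.
exists A, B; split=> //; first exact: nbhsx_ballx.
move=> u' r' nKu'; rewrite /B/ball/= ltr_distlC => rr'.
apply: contrapT => nV; apply: nKu'; split=> //; exists r' => //.
by rewrite /= in_itv/=; lra.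
Qed.

End SmallPaths.

(** * From paths inside one cell to arbitrary paths *)

Section LocalHolonomy.
Variables (R : realType) (X : simplicial_set).
Local Notation RX := (realization R X).
Local Notation char := (characteristic_map R).
Variables (a : cochain R 'F_2 RX 1) (U : set RX) (F : RX -> 'F_2).
Hypothesis az : coboundary a = 0.
Hypothesis oU : open U.
Hypothesis cell_paths : forall n (x : X n) (c : R -> stdsimplex R n),
  continuous c -> (forall r, U (char x (c r))) ->
  path_holonomy a (fun r => char x (c r)) 0 1 = F (char x (c 0)) + F (char x (c 1)).

(** The failure of [F] to be a primitive of [a] along [g]. It is additive in the interval, so by
    [locally_trivial] only short intervals matter. *)
Let D (g : R -> RX) u v := path_holonomy a g u v + (F (g u) + F (g v)).

Lemma cell_paths_itv n (x : X n) (c : R -> stdsimplex R n) u v :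
  continuous c -> (forall r, U (char x (c r))) ->
  path_holonomy a (fun r => char x (c r)) u v = F (char x (c u)) + F (char x (c v)).
Proof.
move=> cc Uc; rewrite -path_holonomy_reparam.
rewrite (@cell_paths n x (fun s => c ((1 - s) * u + s * v)))//.
  by rewrite !subr0 subrr !mul1r !mul0r addr0 add0r.
apply: cts_comp cc; apply: ctsD; apply: ctsM; do ?exact: cts_cst.
  by apply: ctsB; [exact: cts_cst|exact: cts_id].
exact: cts_id.
Qed.

(** Induction on the dimension of the skeleton. Near a time where the path is in a lower cell, it is
    pushed radially into the lower skeleton; near a time where it is in an open top cell, it lifts
    to the simplex and [cell_paths] applies. *)
Lemma small_path_in_skeleton N (g : R -> RX) : continuous g ->
  (forall r, U (g r)) -> (forall r, (cell_dim (g r) < N)%N) ->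
  forall u v, path_holonomy a g u v = F (g u) + F (g v).
Proof.
elim: N g => [|N IH] g cg Ug gN u v; first by have := gN 0.
suff H w : \forall w' \near w, D g w w' = 0.
  have DD w1 w2 w3 : D g w1 w3 = D g w1 w2 + D g w2 w3.
    rewrite /D (path_holonomyD w1 w2 w3 az cg).
    move: (path_holonomy _ _ _ _) (path_holonomy _ _ _ _) (F _) (F _) (F _) => p q r s t.
    have := addrr_F2 r => rr; rewrite -[LHS]addr0 -rr; ring.
  have := locally_trivial DD H u v; rewrite /D => /eqP.
  by rewrite addr_eq0 oppr_F2 => /eqP.
have [wN|wN] := ltnP (cell_dim (g w)) N.
  (* The track from [g w] is constant in [U], so the tracks that start from nearby points of the
     path also remain in [U]. *)
  have oC : \forall r \near w, ~ ((cell_dim (g r) <= N)%N /\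
       exists2 s, `[0, 1]%classic s & ~ U (radial N (g r) s)).
    have cK := @radial_closed R X N U `[0, 1]%classic 0 oU (@segment_compact R 0 1) _.
    have {}cK := cK (ltac:(by rewrite /= in_itv/= lexx ler01)).
    apply: (cg w (~` [set q | (cell_dim q <= N)%N /\ exists2 s, `[0, 1]%classic s & ~ U (radial N q s)])).
    apply: open_nbhs_nbhs; split; first exact: closed_openC cK.
    by move=> [_ [s _]]; rewrite /radial wN; apply; exact: Ug.
  (* The central parts of the [N]-cells, which [push_off] need not carry to the boundary. *)
  pose C : set RX := [set q | exists (x : X N) t,
    [/\ faces X N x, forall i, (2 * N.+1%:R)^-1 <= bc t i & q = char x t]].
  have cC : closed C.
    apply: closed_by_cells => m y ynd.
    have tin (t : stdsimplex R N) :
        (forall i, (2 * N.+1%:R)^-1 <= bc t i) -> inner t.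
      by move=> H i; apply: lt_le_trans (H i); rewrite invr_gt0 mulr_gt0 ?ltr0n.
    have [mN|mN] := eqVneq m N; last first.
      exists set0; split=> //; first exact: closed0.
      move=> t ti [x [t' [xnd t'd E]]]; exfalso; move/eqP: mN; apply.
      rewrite -(cell_dim_inner ynd ti) E cell_dim_inner//; exact: tin t'd.
    subst m; exists [set t | forall i, (2 * N.+1%:R)^-1 <= bc t i]; split.
    - have -> : [set t : stdsimplex R N | forall i, (2 * N.+1%:R)^-1 <= bc t i] =
          \bigcap_i [set t | (2 * N.+1%:R)^-1 <= bc t i].
        by apply/seteqP; split=> t H i; [move=> _|]; exact: H.
      by apply: closed_bigI => i _; exact: closed_bc_ge.
    - by move=> t td; exists y, t.
    - move=> t ti [x [t' [xnd t'd E]]] i.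
      have := @normal_unique _ _ _ y t _ x t' (conj ynd ti) (conj xnd (tin t' t'd)) E.
      move=> yx; have {}yx' : y = x := existT_inj (f_equal (@projT1 _ _) yx).
      by subst x; rewrite (cell_inj yx).
  have nC : \forall r \near w, ~ C (g r).
    apply: (cg w (~` C)); apply: open_nbhs_nbhs; split; first exact: closed_openC cC.
    move=> [x [t [xnd td E]]]; move: wN; rewrite E cell_dim_inner ?ltnn// => i.
    by apply: lt_le_trans (td i); rewrite invr_gt0 mulr_gt0 ?ltr0n.
  have [k [ck kP kw knear]] := localize a (filterI oC nC).
  have Urad r s : U (radial N (g (k r)) s).
    rewrite radial_clamp; apply: contrapT => nU; have [K _] := kP r; apply: K.
    split; first by rewrite -ltnS.
    exists (clamp 0 1 s) => //; rewrite /= in_itv/=; exact: clamp_itv.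
  have cgk : continuous (fun r => g (k r)) by exact: cts_comp.
  have cG := radial_continuous cgk (fun r => ltac:(rewrite -ltnS; exact: gN)).
  have track r : path_holonomy a (radial N (g (k r))) 0 1 =
      F (radial N (g (k r)) 0) + F (radial N (g (k r)) 1).
    have [m [x [c [cc trackE]]]] := radial_track N (g (k r)).
    have -> : radial N (g (k r)) = fun s => char x (c s) by apply/funext.
    by apply: cell_paths => // s; rewrite -trackE.
  have c1 : continuous (fun r => radial N (g (k r)) 1).
    apply: (cts_comp (f := fun r : R => (r, 1 : R))) cG.
    by apply: cts_pair; [exact: cts_id|exact: cts_cst].
  have dim1 r : (cell_dim (radial N (g (k r)) 1) < N)%N.
    have [rN|rN] := ltnP (cell_dim (g (k r))) N; first by rewrite /radial rN.
    have [nfn nfi] := normal_form_normal (g (k r)).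
    have rE : cell_dim (g (k r)) = N by apply/eqP; rewrite eqn_leq rN -ltnS gN.
    have nlt : (cell_dim (g (k r)) < N)%N = false by rewrite ltnNge rN.
    rewrite /radial nlt -[X in (_ < X)%N]rE; apply: cell_dim_boundary.
    have [_ nCr] := kP r.
    have [i ni] : exists i, bc (cell_point (normal_form (g (k r)))) i <
        (2 * (cell_dim (g (k r))).+1%:R)^-1.
      apply: contrapT => /forallNP nltc; apply: nCr.
      rewrite /C /= -(normal_formK (g (k r))).
      have ge i : (2 * (cell_dim (g (k r))).+1%:R)^-1 <=
        bc (cell_point (normal_form (g (k r)))) i by rewrite leNgt; apply/negP; exact: nltc.
      move: ge nfn; move: (cell_simplex _) (cell_point _); rewrite -/(cell_dim _) rE.
      by move=> x t td xnd; exists x, t.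
    exact: push_off1 ni.
  near=> w'.
  have [kw' kpath] : k w' = w' /\
      forall g0 : R -> RX, path_holonomy a g0 w w' = path_holonomy a (g0 \o k) w w'.
    by near: w'.
  rewrite /D kpath.
  have -> : g \o k = fun r => radial N (g (k r)) 0.
    by apply/funext => r; rewrite radial0.
  (* In the square swept out by the deformation, the far side lies in a lower skeleton and is
     handled by induction; the two lateral sides are tracks. *)
  rewrite (square_holonomy w w' az cG)/= (IH _ c1 (fun r => Urad r 1) dim1) !track.
  rewrite !radial0 kw kw'.
  move: (F _) (F _) (F _) (F _) => p q r s.
  rewrite (_ : _ + _ = (p + p) + (q + q) + (r + r) + (s + s)); last by ring.
  by rewrite !addrr_F2.
have wE : cell_dim (g w) = N by apply/eqP; rewrite eqn_leq wN -ltnS gN.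
have [xnd ti] := normal_form_normal (g w).
have gwE := normal_formK (g w).
move: xnd ti gwE; move: (cell_simplex _) (cell_point _); rewrite -/(cell_dim _) wE.
move=> x t xnd ti gwE.
have [e /= e0 te] : exists2 e : R, 0 < e & forall i, e < bc t i.
  have : \forall e \near 0^'+, forall i, e < bc t i.
    by apply: filter_forall => i; exact: nbhs_right_lt.
  move=> /(filterI (nbhs_right_gt (0 : R))) /filter_ex[e [e0 ei]].
  by exists e.
(* The complement, within the [N]-skeleton, of the part of the cell of [x] where all coordinates
   exceed [e]. Near [w] the path avoids [C], hence stays in this cell. *)
pose C : set RX := [set q | (cell_dim q <= N)%N /\
   ~ exists t', (forall i, e < bc t' i) /\ q = char x t'].
have ein t' : (forall i, e < bc t' i) -> inner t'.
  by move=> H i; exact: lt_trans (H i).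
have same m (y : X m) t1 t2 : faces X m y -> inner t1 -> inner t2 ->
    char y t1 = char x t2 -> cell y t1 = cell x t2.
  by move=> *; apply: normal_unique.
have cC : closed C.
  apply: closed_by_cells => m y ynd.
  have [mN|Nm] := leqP m N; last first.
    exists set0; split=> //; first exact: closed0.
    by move=> t' t'i [+ _]; rewrite cell_dim_inner// leqNgt Nm.
  have [yx|yx] := pselect (existT X m y = existT X N x).
    have mE : m = N := f_equal (@projT1 _ _) yx.
    subst m; have {}yx : y = x := existT_inj yx; subst y.
    exists (\bigcup_(i in [set: 'I_N.+1]) [set t' | bc t' i <= e]); split.
    - by apply: closed_bigcup => [|i _]; [exact: finite_finset|exact: closed_bc_le].
    - move=> t1 [i _ /= t1e]; split; first exact: cell_dim_char.
      move=> [t2 [t2e E]].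
      have [t1i|/cell_dim_boundary] := pselect (inner t1).
        by have := cell_inj (same _ _ _ _ xnd t1i (ein _ _ t2e) E) => t12;
          have := t2e i; rewrite -t12 ltNge t1e.
      by move=> /(_ _ x); rewrite E cell_dim_inner ?ltnn//; exact: ein.
    - move=> t1 t1i [_ nt1]; apply: contrapT => H; apply: nt1; exists t1; split=> // i.
      by rewrite ltNge; apply/negP => ?; apply: H; exists i.
  exists setT; split; [exact: closedT| |by []].
  move=> t1 _; split; first by rewrite (leq_trans (cell_dim_char _ _)).
  move=> [t2 [t2e E]].
  have [t1i|/cell_dim_boundary] := pselect (inner t1).
    by apply: yx; have /(f_equal (@projT1 _ _)) := same _ _ _ _ ynd t1i (ein _ _ t2e) E.
  move=> /(_ _ y); rewrite E cell_dim_inner//; last exact: ein.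
  by rewrite ltnNge mN.
have nC : \forall r \near w, ~ C (g r).
  apply: (cg w (~` C)); apply: open_nbhs_nbhs; split; first exact: closed_openC cC.
  by move=> [_]; apply; exists t; rewrite gwE.
have [k [ck kP kw knear]] := localize a nC.
have /choice[c cP] : forall r, exists t', (forall i, e < bc t' i) /\ g (k r) = char x t'.
  move=> r; apply: contrapT => nt; apply: (kP r); split=> //.
  by rewrite -ltnS.
(* Continuity of the lift is tested on closed sets. Cutting [B] down to coordinates at least [e]
   keeps it inside the open cell, where [char x] is injective, and makes its image closed in the
   realization. *)
have cc : continuous c.
  apply/continuous_closedP => B cB.
  pose B' := B `&` \bigcap_i [set t' : stdsimplex R N | e <= bc t' i].
  have cB' : closed B'.
    by apply: closedI => //; apply: closed_bigI => i _; exact: closed_bc_ge.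
  have B'in t' : B' t' -> inner t'.
    by move=> [_ H] i; apply: lt_le_trans (H i I).
  have -> : c @^-1` B = (fun r => g (k r)) @^-1` (char x @` B').
    apply/seteqP; split=> r /=.
      move=> Bc; have [ce gc] := cP r; exists (c r) => //; split=> // i _.
      exact/ltW/ce.
    move=> [t1 B't1]; have [ce ->] := cP r => E.
    rewrite -(cell_inj (same _ _ _ _ xnd (B'in _ B't1) (ein _ _ ce) E)).
    by case: B't1.
  apply: closed_comp => [r _|]; first exact: cts_comp.
  apply: closed_by_cells => m y ynd.
  have [yx|yx] := pselect (existT X m y = existT X N x).
    have mN : m = N := f_equal (@projT1 _ _) yx.
    subst m; have {}yx : y = x := existT_inj yx; subst y.
    exists B'; split; [exact: cB'|by move=> t1 B't1; exists t1|].
    move=> t1 t1i [t2 B't2 E]; by rewrite -(cell_inj (same _ _ _ _ xnd (B'in _ B't2) t1i E)).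
  exists set0; split=> //; first exact: closed0.
  move=> t1 t1i [t2 B't2 E]; apply: yx.
  by have /(f_equal (@projT1 _ _)) := same _ _ _ _ ynd t1i (B'in _ B't2) (esym E).
near=> w'.
have [kw' kpath] : k w' = w' /\
    forall g0 : R -> RX, path_holonomy a g0 w w' = path_holonomy a (g0 \o k) w w'.
  by near: w'.
have gkE : g \o k = fun r => char x (c r) by apply/funext => r; have [] := cP r.
rewrite /D kpath gkE cell_paths_itv//; last by move=> r; have [_ <-] := cP r.
have [_ <-] := cP w; have [_ <-] := cP w'; rewrite kw kw'.
exact: addrr_F2.
Unshelve. all: by end_near. Qed.

(** By [locally_bounded_dim] a path stays, for a short time, in a skeleton of finite dimension,
    where [small_path_in_skeleton] applies. *)
Theorem small_paths (g : R -> RX) : continuous g -> (forall r, U (g r)) ->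
  forall u v, path_holonomy a g u v = F (g u) + F (g v).
Proof.
move=> cg Ug u v.
suff H w : \forall w' \near w, D g w w' = 0.
  have DD w1 w2 w3 : D g w1 w3 = D g w1 w2 + D g w2 w3.
    rewrite /D (path_holonomyD w1 w2 w3 az cg).
    move: (path_holonomy _ _ _ _) (path_holonomy _ _ _ _) (F _) (F _) (F _) => p q r s t.
    have := addrr_F2 r => rr; rewrite -[LHS]addr0 -rr; ring.
  have := locally_trivial DD H u v; rewrite /D => /eqP.
  by rewrite addr_eq0 oppr_F2 => /eqP.
have [N gN] := locally_bounded_dim w cg.
have [k [ck kP kw knear]] := localize a gN.
near=> w'.
have [kw' kpath] : k w' = w' /\
    forall g0 : R -> RX, path_holonomy a g0 w w' = path_holonomy a (g0 \o k) w w'.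
  by near: w'.
rewrite /D kpath (@small_path_in_skeleton N (g \o k))//=; last exact: cts_comp.
rewrite kw kw'; exact: addrr_F2.
Unshelve. all: by end_near. Qed.

End LocalHolonomy.

(** * Barycentric subdivision *)

(* Chains of ordered affine simplices are represented by sequences of points, and
   operators on chains by their transposes acting on functions of such sequences. *)
Section FormalSubdivision.
Variables (P : Type) (b : seq P -> P).
Implicit Types (phi psi : seq P -> 'F_2) (w : seq P).

Definition del i w : seq P := take i w ++ drop i.+1 w.

Lemma size_del i w : (i < size w)%N -> size (del i w) = (size w).-1.
Proof. by move=> iw; rewrite size_cat size_take size_drop iw; lia. Qed.

Lemma nth_del x0 i w j : (i < size w)%N -> nth x0 (del i w) j = nth x0 w (bump i j).
Proof.
move=> iw; rewrite nth_cat size_take iw /bump; case: (ltnP j i) => ji.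
  by rewrite nth_take.
by rewrite nth_drop; congr nth; lia.
Qed.

(** The augmented coboundary modulo two: on a one-point sequence its value is [phi [::]]. *)
Definition bd phi w : 'F_2 := \sum_(i < size w) phi (del i w).

Lemma bd_cons phi p w : bd phi (p :: w) = phi w + bd (fun v => phi (p :: v)) w.
Proof. by rewrite /bd/= big_ord_recl/= /del/= drop0. Qed.

Lemma bdD phi psi w : bd (fun v => phi v + psi v) w = bd phi w + bd psi w.
Proof. exact: big_split. Qed.

Lemma bd_ext phi psi w : phi =1 psi -> bd phi w = bd psi w.
Proof. by move=> E; apply: eq_bigr => i _; exact: E. Qed.

Lemma bd_bd phi w : bd (bd phi) w = 0.
Proof.
elim: w phi => [|p w IH] phi; first by rewrite /bd big_ord0.
rewrite bd_cons (bd_ext _ (bd_cons phi p)) bdD IH addr0.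
exact: addrr_F2.
Qed.

(** Transpose of the recursion that sends a simplex to the cone from its barycentre over its
    subdivided boundary. The counter [k] is the size of [w], since [del i w] is not structurally
    smaller. *)
Fixpoint subdivide_rec k phi w : 'F_2 :=
  if k is k'.+1 then
    \sum_(i < k'.+1) subdivide_rec k' (fun v => phi (b w :: v)) (del i w)
  else phi w.

Definition subdivide phi w := subdivide_rec (size w) phi w.

(** Transpose of [T s = b (s + T (bd s))], where [b] is the cone from the barycentre of the simplex
    [s]. *)
Fixpoint homotopy_rec k phi w : 'F_2 :=
  if k is k'.+1 then phi (b w :: w) +
    \sum_(i < k'.+1) homotopy_rec k' (fun v => phi (b w :: v)) (del i w)
  else 0.

Definition homotopy phi w := homotopy_rec (size w) phi w.

Lemma subdivide_unfold phi w : (0 < size w)%N ->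
  subdivide phi w = bd (subdivide (fun v => phi (b w :: v))) w.
Proof.
rewrite /subdivide /bd; case E : (size w) => [//|k] _ /=.
by apply: eq_bigr => i _; rewrite size_del E.
Qed.

Lemma homotopy_unfold phi w : (0 < size w)%N ->
  homotopy phi w = phi (b w :: w) + bd (homotopy (fun v => phi (b w :: v))) w.
Proof.
rewrite /homotopy /bd; case E : (size w) => [//|k] _ /=; congr (_ + _).
by apply: eq_bigr => i _; rewrite size_del E.
Qed.

Lemma seq_size_ind (Q : seq P -> Prop) :
  Q [::] ->
  (forall w, (0 < size w)%N -> (forall i, (i < size w)%N -> Q (del i w)) -> Q w) ->
  forall w, Q w.
Proof.
move=> Q0 QS w; have [k] := ubnP (size w); elim: k w => // k IH w wk.
case E : (size w) => [|m]; first by rewrite (size0nil E).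
by apply: QS; rewrite E// => i im; apply: IH; rewrite size_del ?E//=; lia.
Qed.

Lemma eq_bd_size phi psi w :
  (forall i, (i < size w)%N -> phi (del i w) = psi (del i w)) -> bd phi w = bd psi w.
Proof. by move=> E; apply: eq_bigr => i _; exact: E. Qed.

Lemma subdivide_ext phi psi w : (forall v, size v = size w -> phi v = psi v) ->
  subdivide phi w = subdivide psi w.
Proof.
elim/seq_size_ind: w phi psi => [|w w0 IH] phi psi E; first exact: E.
rewrite !subdivide_unfold//; apply: eq_bd_size => i iw; apply: IH => // v vw.
by apply: E => /=; rewrite vw size_del//; lia.
Qed.

Lemma homotopy_ext phi psi w : (forall v, size v = (size w).+1 -> phi v = psi v) ->
  homotopy phi w = homotopy psi w.
Proof.
elim/seq_size_ind: w phi psi => [//|w w0 IH] phi psi E.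
rewrite !homotopy_unfold//; congr (_ + _); first exact: E.
apply: eq_bd_size => i iw; apply: IH => // v vw.
by apply: E => /=; rewrite vw size_del//; lia.
Qed.

Lemma subdivideD phi psi w :
  subdivide (fun v => phi v + psi v) w = subdivide phi w + subdivide psi w.
Proof.
elim/seq_size_ind: w phi psi => [//|w w0 IH] phi psi.
by rewrite !subdivide_unfold// -bdD; apply: eq_bd_size => i iw; exact: IH.
Qed.

Lemma homotopyD phi psi w :
  homotopy (fun v => phi v + psi v) w = homotopy phi w + homotopy psi w.
Proof.
elim/seq_size_ind: w phi psi => [|w w0 IH] phi psi; first by rewrite addr0.
rewrite !homotopy_unfold// addrACA -bdD; congr (_ + _).
by apply: eq_bd_size => i iw; exact: IH.
Qed.

Lemma homotopy0 w : homotopy (fun _ => 0) w = 0.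
Proof.
by have := homotopyD (fun=> 0) (fun=> 0) w; rewrite !addrr_F2.
Qed.

Lemma subdivide0 w : subdivide (fun _ => 0) w = 0.
Proof.
by have := subdivideD (fun=> 0) (fun=> 0) w; rewrite !addrr_F2.
Qed.

(** By [bd_cons], the boundary of a cone is its base plus the cone on the boundary of the base. Here
    the base is the subdivided boundary, which by induction is closed because [bd_bd] vanishes. *)
Lemma subdivide_bd phi w : subdivide (bd phi) w = bd (subdivide phi) w.
Proof.
elim/seq_size_ind: w phi => [|w w0 IH] phi; first by rewrite /bd/subdivide/= !big_ord0.
rewrite subdivide_unfold//.
transitivity (bd (fun v => subdivide phi v +
    bd (subdivide (fun u => phi (b w :: u))) v) w); last by rewrite bdD bd_bd addr0.
apply: eq_bd_size => i iw; rewrite -IH// -subdivideD; apply: subdivide_ext => v _.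
exact: bd_cons.
Qed.

(** The chain homotopy from the identity to subdivision, by induction on faces: in the boundary of
    the cone, all terms but these cancel in pairs modulo two. *)
Lemma homotopy_bd phi w :
  homotopy (bd phi) w + bd (homotopy phi) w = phi w + subdivide phi w.
Proof.
elim/seq_size_ind: w phi => [|w w0 IH] phi.
  by rewrite /bd/homotopy/subdivide/= big_ord0 !addrr_F2.
rewrite homotopy_unfold// bd_cons (subdivide_unfold phi w0).
set phib := fun v => phi (b w :: v).
have -> : bd (homotopy (fun v => bd phi (b w :: v))) w =
    bd (fun v => homotopy phi v + (bd (homotopy phib) v + (phib v + subdivide phib v))) w.
  apply: eq_bd_size => i iw.
  rewrite -IH// [bd _ _ + _]addrC -addrA addrr_F2 addr0 -homotopyD.
  by apply: homotopy_ext => v _; exact: bd_cons.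
rewrite !bdD bd_bd add0r.
rewrite -(addrA (phi w)) -(addrA (phi w)); congr (_ + _).
move: (bd phib w) (bd (homotopy phi) w) (bd (subdivide phib) w) => p q r.
by rewrite -[RHS]addr0 -[RHS]addr0 -{1}(addrr_F2 p) -(addrr_F2 q); ring.
Qed.

End FormalSubdivision.

Lemma map_del (P Q : Type) (f : P -> Q) i w : map f (del i w) = del i (map f w).
Proof. by rewrite /del map_cat map_take map_drop. Qed.

Section Naturality.
Variables (P Q : Type) (b : seq P -> P) (c : seq Q -> Q) (f : P -> Q).
Hypothesis fb : forall w, (0 < size w)%N -> f (b w) = c (map f w).

Lemma bd_map phi w : bd phi (map f w) = bd (fun v => phi (map f v)) w.
Proof. by rewrite /bd size_map; apply: eq_bigr => i _; rewrite map_del. Qed.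

Lemma subdivide_map phi w :
  subdivide c phi (map f w) = subdivide b (fun v => phi (map f v)) w.
Proof.
elim/seq_size_ind: w phi => [//|w w0 IH] phi.
rewrite !subdivide_unfold ?size_map// bd_map; apply: eq_bd_size => i iw.
by rewrite IH//=; apply: subdivide_ext => v _; rewrite fb.
Qed.

Lemma homotopy_map phi w :
  homotopy c phi (map f w) = homotopy b (fun v => phi (map f v)) w.
Proof.
elim/seq_size_ind: w phi => [//|w w0 IH] phi.
rewrite !homotopy_unfold ?size_map//= fb// bd_map; congr (_ + _).
apply: eq_bd_size => i iw.
by rewrite IH//=; apply: homotopy_ext => v _.
Qed.

End Naturality.

Section Barycenters.
Variable R : realType.

Lemma uniform_subproof n :
  (forall i : 'I_n.+1, 0 <= n.+1%:R^-1 :> R) /\ \sum_(i < n.+1) n.+1%:R^-1 = 1 :> R.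
Proof.
split=> [i|]; first by rewrite invr_ge0.
by rewrite sumr_const card_ord -[X in X = _]mulr_natl divff// pnatr_eq0.
Qed.

(** The index type is never empty, so that [affine] applies; on the empty sequence the value is the
    default vertex of [nth]. *)
Definition barycenter n (w : seq (stdsimplex R n)) : stdsimplex R n :=
  affine (fun j : 'I_(size w).-1.+1 => nth (vertex R ord0) w j)
    (mksimplex (uniform_subproof (size w).-1)).

Lemma bc_barycenter n (w : seq (stdsimplex R n)) i : (0 < size w)%N ->
  bc (barycenter w) i = (\sum_(p <- w) bc p i) / (size w)%:R.
Proof.
move=> w0; rewrite bc_affine.
under eq_bigr do rewrite bc_mksimplex.
rewrite -big_distrr/= mulrC prednK//; congr (_ / _).
by rewrite (big_nth (vertex R ord0)) big_mkord.
Qed.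

Lemma barycenter_push m n (f : 'I_m.+1 -> 'I_n.+1) (w : seq (stdsimplex R m)) :
  (0 < size w)%N -> push f (barycenter w) = barycenter (map (push f) w).
Proof.
move=> w0; apply: bc_inj => i; rewrite bc_push bc_barycenter ?size_map// big_map.
rewrite (eq_bigr (fun j => (\sum_(p <- w) bc p j) / (size w)%:R)); last first.
  by move=> j _; rewrite bc_barycenter.
rewrite -big_distrl/= exchange_big/=; congr (_ / _).
by apply: eq_bigr => p _; rewrite bc_push.
Qed.

Definition diameter_le n (d : R) (w : seq (stdsimplex R n)) :=
  forall p q, p \in w -> q \in w -> forall i, bc p i - bc q i <= d.

Lemma barycenter_in_box n (c : stdsimplex R n) (d : R) (w : seq (stdsimplex R n)) :
  (0 < size w)%N -> (forall p, p \in w -> forall i, `|bc p i - bc c i| <= d) ->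
  forall i, `|bc (barycenter w) i - bc c i| <= d.
Proof.
move=> w0 wd i; have s0 : 0 < (size w)%:R :> R by rewrite ltr0n.
have -> : bc (barycenter w) i - bc c i = (\sum_(p <- w) (bc p i - bc c i)) / (size w)%:R.
  rewrite bc_barycenter// sumrB mulrBl; congr (_ - _).
  by rewrite big_const_seq count_predT iter_addr_0 -[X in X / _]mulr_natr mulfK// gt_eqF.
rewrite normrM normfV [`|_%:R|]gtr0_norm// ler_pdivrMr//.
rewrite (le_trans (ler_norm_sum _ _ _))//.
rewrite (@le_trans _ _ (\sum_(p <- w) d))//; last first.
  by rewrite big_const_seq count_predT iter_addr_0 -[X in X <= _]mulr_natr.
by rewrite big_seq [leRHS]big_seq; apply: ler_sum => p pw; exact: wd.
Qed.

(** In the average of the differences [bc v i - bc p i], the term for [v] itself vanishes. This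
    yields the usual contraction factor. *)
Lemma barycenter_dist n (w : seq (stdsimplex R n)) (d r : R) (v : stdsimplex R n) :
  diameter_le d w -> 0 <= d -> (size w)%:R - 1 <= r * (size w)%:R -> v \in w ->
  forall i, `|bc v i - bc (barycenter w) i| <= r * d.
Proof.
move=> wd d0 rw vw i.
have w0 : (0 < size w)%N by case: (w) vw.
have s0 : 0 < (size w)%:R :> R by rewrite ltr0n.
have -> : bc v i - bc (barycenter w) i = (\sum_(p <- w) (bc v i - bc p i)) / (size w)%:R.
  rewrite bc_barycenter// sumrB mulrBl; congr (_ - _).
  by rewrite big_const_seq count_predT iter_addr_0 -[X in X / _]mulr_natr mulfK// gt_eqF.
rewrite normrM normfV [`|_%:R|]gtr0_norm// ler_pdivrMr//.
rewrite (big_rem v)//= subrr add0r (le_trans (ler_norm_sum _ _ _))//.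
rewrite (@le_trans _ _ (\sum_(p <- rem v w) d))//.
  rewrite big_seq [leRHS]big_seq; apply: ler_sum => p /mem_rem pw.
  by rewrite ler_norml lerNl opprB !wd.
rewrite big_const_seq count_predT iter_addr_0 size_rem// -[X in X <= _]mulr_natr.
rewrite -subn1 natrB// mulrC; apply: le_trans (_ : r * (size w)%:R * d <= _).
  by rewrite ler_wpM2r.
by rewrite mulrAC.
Qed.

(** [K] makes the induction go through: on passing to a face, closeness to the barycentre just
    chosen is added to it. Being a box condition, this is inherited by all later barycentres. *)
Lemma subdivide_small n (d r : R) (K : stdsimplex R n -> Prop) phi w :
  0 <= d -> 0 <= r <= 1 -> (size w)%:R - 1 <= r * (size w)%:R ->
  (forall v, (0 < size v)%N -> (forall p, p \in v -> K p) -> K (barycenter v)) ->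
  (forall p, p \in w -> K p) -> diameter_le d w ->
  (forall v, size v = size w -> (forall p, p \in v -> K p) -> diameter_le (r * d) v ->
    phi v = 0) ->
  subdivide (@barycenter n) phi w = 0.
Proof.
move=> d0 /andP[r0 r1]; elim/seq_size_ind: w K phi => [|w w0 IH] K phi rw Kb Kw wd phi0.
  exact: phi0.
rewrite subdivide_unfold// /bd big1// => -[i iw] _ /=.
have dw p : p \in del i w -> p \in w.
  by rewrite mem_cat => /orP[/mem_take|/mem_drop].
pose K' p := K p /\ forall j, `|bc p j - bc (barycenter w) j| <= r * d.
apply: (IH i iw K') => //.
- rewrite size_del//; move: w0 rw; case: (size w) => //= k _; rewrite -natr1; nra.
- move=> v v0 vK; split; first by apply: Kb => // p /vK[].
  by apply: barycenter_in_box => // p /vK[].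
- by move=> p /dw pw; split; [exact: Kw|exact: barycenter_dist].
- by move=> p q /dw pw /dw qw; exact: wd.
- move=> v vw vK vd; apply: phi0 => /=; first by rewrite vw size_del// prednK.
    by move=> p; rewrite inE => /orP[/eqP->|/vK[]//]; exact: Kb.
  move=> p q; rewrite !inE => /orP[/eqP->|pv] /orP[/eqP->|qv] j.
  + by rewrite subrr mulr_ge0.
  + have [_ /(_ j)] := vK q qv; rewrite distrC; exact: le_trans (ler_norm _).
  + have [_ /(_ j)] := vK p pv; exact: le_trans (ler_norm _).
  + exact: vd.
Qed.

Lemma iter_subdivide_small n (e r : R) m phi (w : seq (stdsimplex R n)) (d : R) :
  0 <= d -> 0 <= r <= 1 -> (size w)%:R - 1 <= r * (size w)%:R ->
  diameter_le d w -> r ^+ m * d <= e ->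
  (forall v, size v = size w -> diameter_le e v -> phi v = 0) ->
  iter m (subdivide (@barycenter n)) phi w = 0.
Proof.
move=> + r01; elim: m d w => [|m IH] d w d0 rw wd de phi0.
  by apply: phi0 => // p q pw qw i; rewrite (le_trans (wd _ _ pw qw i))// -[d]mul1r.
rewrite iterS; apply: (subdivide_small (K := fun _ => True) d0 r01 rw) => //.
move=> v vw _ vd; apply: (IH (r * d)); rewrite ?vw//.
  by rewrite mulr_ge0//; case/andP: r01.
by rewrite mulrA -exprSr.
Qed.

End Barycenters.

(** * Cocycles that vanish on small simplices *)

Section SmallSimplices.
Variable R : realType.

Lemma simplex_set_compact n : compact (@simplex_set R n).
Proof.
apply: (@subclosed_compact _ _ [set v : 'rV[R]_n.+1 | forall i, `[0, 1]%classic (v ord0 i)]).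
- have -> : @simplex_set R n =
      (\bigcap_i ((fun t : 'rV[R]_n.+1 => t ord0 i) @^-1` [set r | 0 <= r])) `&`
      ((fun t : 'rV[R]_n.+1 => \sum_i t ord0 i) @^-1` [set 1]).
    by apply/seteqP; split=> t [t0 t1]; split=> // i; [move=> _|]; exact: t0.
  apply: closedI.
    apply: closed_bigI => i _; apply: closed_comp => [t _|]; last exact: closed_ge.
    exact: coord_continuous.
  apply: closed_comp => [t _|]; last exact: closed_eq.
  by apply: cts_sum => i; exact: coord_continuous.
- by apply: (@rV_compact R n.+1 (fun _ => `[0, 1]%classic)) => i; exact: segment_compact.
- move=> t [t0 t1] i; rewrite /= in_itv/= t0/= -t1 (bigD1 i)//= lerDl.
  by apply: sumr_ge0.
Qed.

(** Compactness of the simplex in near-covering form, with the radius [e] as parameter. Around each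
    point, half the radius of a ball inside a preimage is left for [e]. *)
Lemma Lebesgue_number (Y : topologicalType) (I : Type) (U : I -> set Y) n
    (s : stdsimplex R n -> Y) :
  (forall i, open (U i)) -> (forall y, exists i, U i y) -> continuous s ->
  exists2 e : R, 0 < e & forall p, exists i, forall q,
    (forall j, `|bc q j - bc p j| <= e) -> U i (s q).
Proof.
move=> oU cU cs.
pose Q (e : R) (v : 'rV[R]_n.+1) := exists i, forall q : stdsimplex R n,
  (forall j, `|bc q j - v ord0 j| <= e) -> U i (s q).
have /compact_near_coveringP cov := @simplex_set_compact n.
have : \forall e \near (0 : R)^'+, @simplex_set R n `<=` Q e.
  apply: (cov _ _ Q) => v vs.
  pose p : stdsimplex R n := exist (fun u => u \in @simplex_set R n) v (mem_set vs).
  have [i Uip] := cU (s p).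
  have : nbhs p (s @^-1` U i) by apply: cs; apply: open_nbhs_nbhs.
  rewrite nbhsE => -[_ [[W oW <-] Wp] WU].
  have /nbhs_ballP[d /= d0 dW] : nbhs v W by apply: open_nbhs_nbhs.
  have d20 : 0 < d / 2 by rewrite divr_gt0.
  exists (ball v (d / 2), [set e : R | e < d / 2]) => /=.
    by split; [exact: nbhsx_ballx|exact: nbhs_right_lt].
  move=> [v' e] /= [vv' ed]; exists i => q qv'; apply: WU => /=; apply: dW.
  split=> // k j; rewrite (ord1 k) /ball/=.
  have [_ /(_ ord0 j)] := vv'; rewrite /ball/= => vv'j.
  have := qv' j; rewrite /bc => qv'j.
  rewrite (le_lt_trans (ler_distD (v' ord0 j) _ _))//.
  by rewrite [ltRHS](splitr d) ltrD// distrC (le_lt_trans qv'j).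
move=> /(filterI (nbhs_right_gt (0 : R))) /filter_ex[e [e0 eQ]].
exists e => // p; exact: (eQ (set_val p) (set_valP p)).
Qed.

Lemma affine_near n k (w : seq (stdsimplex R n)) (e : R) t j :
  size w = k.+1 -> diameter_le e w ->
  `|bc (affine (fun i : 'I_k.+1 => nth (vertex R ord0) w i) t) j -
    bc (nth (vertex R ord0) w 0) j| <= e.
Proof.
move=> wk wd; rewrite bc_affine -[bc (nth _ w 0) j]mul1r -(bc_sum t) big_distrl/=.
rewrite -sumrB (le_trans (ler_norm_sum _ _ _))// -[leRHS]mul1r -(bc_sum t) big_distrl/=.
apply: ler_sum => i _; rewrite -mulrBr normrM ger0_norm ?bc_ge0// ler_wpM2l ?bc_ge0//.
by rewrite ler_norml lerNl opprB !wd// mem_nth// wk.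
Qed.

Variables (Y : topologicalType) (I : Type) (U : I -> set Y) (n : nat).
Variable a : cochain R 'F_2 Y n.+1.
Hypothesis oU : forall i, open (U i).
Hypothesis cU : forall y, exists i, U i y.
Hypothesis az : coboundary a = 0.
Hypothesis a_small : forall s : singular R Y n.+1,
  (exists i, forall t, U i (s t)) -> a s = 0.

Local Notation sd := (subdivide (@barycenter R _)).
Local Notation ht := (homotopy (@barycenter R _)).

Definition affine_value N (s : stdsimplex R N -> Y) (w : seq (stdsimplex R N)) : 'F_2 :=
  ev a (fun t => s (affine (fun j : 'I_n.+2 => nth (vertex R ord0) w j) t)).

Lemma bd_affine_value N (s : stdsimplex R N -> Y) w :
  continuous s -> size w = n.+3 -> bd (affine_value s) w = 0.
Proof.
move=> cs wn.
have := @ev_cocycle _ _ _ a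
  (fun t => s (affine (fun j : 'I_n.+3 => nth (vertex R ord0) w j) t)) az.
move=> /(_ (cts_comp (@affine_continuous _ _ _ _) cs)) <-.
rewrite /bd wn; apply: eq_bigr => i _; congr ev; apply/funext => t /=.
rewrite affine_push; congr (s (affine _ t)); apply/funext => j /=.
by rewrite nth_del ?wn.
Qed.

Lemma iter_bd N m (phi : seq (stdsimplex R N) -> 'F_2) w :
  (forall v, size v = n.+3 -> bd phi v = 0) -> size w = n.+3 ->
  bd (iter m sd phi) w = 0.
Proof.
move=> phi0; elim: m w => [|m IH] w wn; first exact: phi0.
rewrite iterS -subdivide_bd.
rewrite (@subdivide_ext _ _ _ (fun=> 0)) ?subdivide0// => v vw.
by apply: IH; rewrite vw.
Qed.

(** The chain homotopy from the identity to the [m]-fold subdivision. *)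
Definition total_homotopy N (phi : seq (stdsimplex R N) -> 'F_2) m w : 'F_2 :=
  \sum_(j < m) ht (iter j sd phi) w.

Lemma bd_total_homotopy N (phi : seq (stdsimplex R N) -> 'F_2) m w :
  (forall v, size v = n.+3 -> bd phi v = 0) -> size w = n.+2 ->
  bd (total_homotopy phi m) w = phi w + iter m sd phi w.
Proof.
move=> phi0 wn; elim: m => [|m IH].
  by rewrite addrr_F2 /bd big1// => i _; rewrite /total_homotopy big_ord0.
have -> : bd (total_homotopy phi m.+1) w =
    bd (total_homotopy phi m) w + bd (ht (iter m sd phi)) w.
  by rewrite -bdD; apply: bd_ext => v; rewrite /total_homotopy big_ord_recr.
have := homotopy_bd (@barycenter R N) (iter m sd phi) w.
rewrite [homotopy _ _ w](@homotopy_ext _ _ _ (fun=> 0)); last first.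
  by move=> v vw; apply: iter_bd => //; rewrite vw wn.
rewrite homotopy0 add0r => ->; rewrite IH iterS addrA.
by congr (_ + _); rewrite -addrA addrr_F2 addr0.
Qed.

Lemma eventually_zero N (s : stdsimplex R N -> Y) : continuous s ->
  exists M, forall m w, (M <= m)%N -> size w = n.+2 -> iter m sd (affine_value s) w = 0.
Proof.
move=> cs; have [e e0 He] := Lebesgue_number oU cU cs.
(* Sequences of [n.+2] points span simplices of dimension [n.+1], which a subdivision contracts by
   this factor. *)
pose r : R := 1 - n.+2%:R^-1.
have n0 : 0 < n.+2%:R :> R by rewrite ltr0n.
have n1 : n.+2%:R^-1 <= 1 :> R by rewrite invf_le1// ler1n.
have ni : 0 < n.+2%:R^-1 :> R by rewrite invr_gt0.
have [r01 r1] : 0 <= r <= 1 /\ r < 1.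
  by rewrite /r; move: n1 ni; move: (_^-1) => z; lra.
have [M _ HM] : \forall m \near \oo, r ^+ m < e.
  have := @cvg_expr R r; rewrite ger0_norm; last by case/andP: r01.
  by move=> /(_ r1)/cvgr_lt; apply.
exists M => m w Mm wn.
apply: (@iter_subdivide_small R N e r m _ w 1) => //.
- by rewrite wn /r mulrBl mul1r mulVf ?gt_eqF.
- move=> p q _ _ i; have := bc_le1 p i; have := bc_ge0 q i; lra.
- by rewrite mulr1 ltW// HM.
- move=> v; rewrite wn => vn vd.
  have [i Hi] := He (nth (vertex R ord0) v 0).
  have cv : continuous (fun t => s (affine (fun j : 'I_n.+2 => nth (vertex R ord0) v j) t)).
    exact: cts_comp (@affine_continuous _ _ _ _) cs.
  rewrite /affine_value -[X in ev a X]/(mkcts cv : _ -> _) ev_singular.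
  apply: a_small; exists i => t; apply: Hi => j; exact: affine_near.
Qed.

(** The number of subdivisions required depends on the singular simplex. Further rounds contribute
    zero, so different simplices can be compared at a common number. *)
Lemma total_homotopy_stable N (s : stdsimplex R N -> Y) M m w :
  (forall m w, (M <= m)%N -> size w = n.+2 -> iter m sd (affine_value s) w = 0) ->
  (M <= m)%N -> size w = n.+1 ->
  total_homotopy (affine_value s) m w = total_homotopy (affine_value s) M w.
Proof.
move=> HM; elim: m => [|m IH]; first by rewrite leqn0 => /eqP ->.
rewrite leq_eqVlt => /predU1P[->//|]; rewrite ltnS => Mm wn.
rewrite /total_homotopy big_ord_recr/= -/(total_homotopy _ _ _) IH//.
rewrite (@homotopy_ext _ _ _ (fun=> 0)) ?homotopy0 ?addr0// => v vw.
by apply: HM => //; rewrite vw wn.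
Qed.

Definition vertices N : seq (stdsimplex R N) := [seq vertex R i | i <- enum 'I_N.+1].

Lemma size_vertices N : size (vertices N) = N.+1.
Proof. by rewrite size_map size_enum_ord. Qed.

Lemma nth_vertices N (i : 'I_N.+1) : nth (vertex R ord0) (vertices N) i = vertex R i.
Proof. by rewrite (nth_map ord0) ?size_enum_ord// nth_ord_enum. Qed.

Lemma del_vertices N (i : 'I_N.+2) :
  del i (vertices N.+1) = map (push (lift i)) (vertices N).
Proof.
apply: (@eq_from_nth _ (vertex R ord0)).
  by rewrite [RHS]size_map size_del !size_vertices.
move=> j; rewrite size_del ?size_vertices// => jN.
rewrite nth_del ?size_vertices// (nth_map (vertex R ord0)) ?size_vertices//.
rewrite -[j]/(val (Ordinal jN)) nth_vertices push_vertex.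
by rewrite -[bump _ _]/(val (lift i (Ordinal jN))) nth_vertices.
Qed.

Theorem small_cocycle_exact : exists b : cochain R 'F_2 Y n, a = coboundary b.
Proof.
have /choice[M HM] : forall s : singular R Y n, exists M, forall m w,
    (M <= m)%N -> size w = n.+2 -> iter m sd (affine_value s) w = 0.
  by move=> s; apply: eventually_zero; exact: cts_fun.
pose b (s : singular R Y n) : 'F_2 := total_homotopy (affine_value s) (M s) (vertices n).
exists b; apply/funext => s; rewrite /coboundary.
have cs : continuous s by exact: cts_fun.
have [M0 HM0] := eventually_zero cs.
(* Enough rounds for [s] and for all its facets at once; naturality under [push (lift i)] then
   matches the terms of the boundary with the facets. *)
pose m := maxn M0 (\max_(i < n.+2) M (pullback s (lift i))).
have -> : a s = bd (total_homotopy (affine_value s) m) (vertices n.+1).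
  rewrite bd_total_homotopy ?size_vertices//; last by move=> v; exact: bd_affine_value.
  rewrite HM0 ?size_vertices ?leq_maxl// addr0 /affine_value -ev_singular.
  congr ev; apply/funext => t; rewrite -[in LHS](affine_vertices t).
  by congr (s (affine _ t)); apply/funext => j; rewrite nth_vertices.
rewrite /bd size_vertices; apply: eq_bigr => i _; rewrite signr_F2 mul1r /b.
rewrite -(total_homotopy_stable (HM (pullback s (lift i))) (m := m)) ?size_vertices//.
  rewrite del_vertices; apply: eq_bigr => j _.
  rewrite (homotopy_map (b := @barycenter R n)); last by move=> w; exact: barycenter_push.
  apply: homotopy_ext => v; rewrite size_vertices => vn.
  have sdE l w : size w = n.+2 -> iter l sd (affine_value s) (map (push (lift i)) w) =
      iter l sd (affine_value (pullback s (lift i))) w.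
    elim: l w => [|l IH] w wn.
      rewrite /= /affine_value; congr ev; apply/funext => t /=.
      rewrite push_affine; congr (s (affine _ t)); apply/funext => k /=.
      by rewrite (nth_map (vertex R ord0))// wn.
    rewrite !iterS (subdivide_map (b := @barycenter R n)).
      by apply: subdivide_ext => u uw; apply: IH; rewrite uw.
    by move=> u; exact: barycenter_push.
  exact: sdE.
rewrite leq_max; apply/orP; right.
exact: (leq_bigmax (F := fun i : 'I_n.+2 => M (pullback s (lift i))) i).
Qed.

End SmallSimplices.

(** * Sections of the line bundle of a cocycle *)

Section SignedSection.
Variables (R : realType) (X : simplicial_set).
Local Notation RX := (realization R X).
Local Notation char := (characteristic_map R).
Variable a : cochain R 'F_2 RX 1.
Hypothesis az : coboundary a = 0.

Definition pair_of n (t u : stdsimplex R n) (i : 'I_2) := if i == ord0 then t else u.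

Definition line n (x : X n) (t u : stdsimplex R n) : 'F_2 :=
  ev a (fun s => char x (affine (pair_of t u) s)).

Lemma lineD n (x : X n) t u v : line x t v = line x t u + line x u v.
Proof.
pose w (i : 'I_3) := if i == ord0 then t else if i == ord_max then v else u.
have cw : continuous (fun s => char x (affine w s)).
  exact: cts_comp (@affine_continuous _ _ _ w) (@characteristic_map_continuous R X n x).
have := ev_cocycle az cw; rewrite !big_ord_recl big_ord0 addr0.
have E (i : 'I_3) (p q : stdsimplex R n) : w \o lift i =1 pair_of p q ->
    ev a ((fun s => char x (affine w s)) \o push (lift i)) = line x p q.
  move=> /funext wi; congr ev; apply/funext => s /=.
  by rewrite affine_push wi.
rewrite (E _ u v); last by case=> -[|[|]].
rewrite (E _ t v); last by case=> -[|[|]].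
rewrite (E _ t u); last by case=> -[|[|]].
by rewrite addrCA => /eqP; rewrite addr_eq0 oppr_F2 addrC => /eqP.
Qed.

Lemma linexx n (x : X n) t : line x t t = 0.
Proof. by have /eqP := lineD x t t t; rewrite -subr_eq0 opprD addNKr oppr_eq0 => /eqP. Qed.

Lemma lineC n (x : X n) t u : line x t u = line x u t.
Proof.
by have /eqP := lineD x t u t; rewrite linexx eq_sym addr_eq0 oppr_F2 => /eqP.
Qed.

Lemma line_push m n (f : {omorphism 'I_m.+1 -> 'I_n.+1}) (x : X n) t u :
  line (simplex_map f x) t u = line x (push f t) (push f u).
Proof.
congr ev; apply/funext => s; rewrite characteristic_map_push push_affine.
by congr (char x (affine _ s)); apply/funext => i; rewrite /pair_of/=; case: ifP.
Qed.

Lemma path_holonomy_cst (y : RX) u v : path_holonomy a (fun=> y) u v = 0.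
Proof. exact: (path_holonomyxx u az (@cts_cst R RX y)). Qed.

(** The path is coned off to the point [u] inside the simplex: this is a homotopy to a constant
    path, whose lateral sides are straight lines. *)
Lemma path_holonomy_line n (x : X n) (c : R -> stdsimplex R n) u : continuous c ->
  path_holonomy a (fun r => char x (c r)) 0 1 = line x (c 0) u + line x (c 1) u.
Proof.
move=> cc.
pose G (p : R * R) := char x (affine (pair_of (c p.1) u) (interval_point p.2)).
have cG : continuous G.
  apply: cts_comp (@characteristic_map_continuous R X n x).
  apply: continuous_bc => i; under eq_fun do rewrite bc_affine.
  apply: cts_sum => j; apply: ctsM.
    apply: cts_comp (@bc_continuous _ _ j).
    by apply: cts_comp (@interval_point_continuous R); apply: cts_snd; exact: cts_id.
  rewrite /pair_of; case: (j == ord0); last exact: cts_cst.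
  apply: cts_comp (@bc_continuous _ _ i); apply: cts_comp cc.
  by apply: cts_fst; exact: cts_id.
have := square_holonomy 0 1 az cG.
have -> : (fun r => G (r, 0)) = (fun r => char x (c r)).
  by apply/funext => r; rewrite /G/= interval_point0 affine_vertex.
have -> : (fun r => G (r, 1)) = (fun=> char x u).
  by apply/funext => r; rewrite /G/= interval_point1 affine_vertex.
rewrite path_holonomy_cst add0r => ->.
by rewrite /line -!(path_holonomy_singular a).
Qed.

Variable h : RX -> 'F_2.

(** The value that [h] prescribes at the [j]-th vertex, transported to [t] along a straight line; it
    is later read as a sign. *)
Definition vertex_value n (x : X n) (t : stdsimplex R n) j : 'F_2 :=
  line x t (vertex R j) + h (char x (vertex R j)).

(** The value on an edge of [a] corrected by the coboundary of [h]. *)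
Definition edge_value n (x : X n) j k : 'F_2 :=
  line x (vertex R j) (vertex R k) + h (char x (vertex R j)) + h (char x (vertex R k)).

Lemma vertex_valueD n (x : X n) t j k :
  vertex_value x t j + vertex_value x t k = edge_value x j k.
Proof.
by rewrite /vertex_value/edge_value addrACA (lineC _ t) -lineD addrA.
Qed.

Lemma edge_valueD n (x : X n) i j k :
  edge_value x i k = edge_value x i j + edge_value x j k.
Proof.
rewrite -!(vertex_valueD x (vertex R ord0)) -[RHS]addrA.
by rewrite [X in _ = _ + X]addrA addrr_F2 add0r.
Qed.

Lemma edge_valuexx n (x : X n) i : edge_value x i i = 0.
Proof. by rewrite -(vertex_valueD x (vertex R ord0)) addrr_F2. Qed.

Lemma vertex_value_push m n (f : {omorphism 'I_m.+1 -> 'I_n.+1}) (x : X n) t j :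
  vertex_value (simplex_map f x) t j = vertex_value x (push f t) (f j).
Proof. by rewrite /vertex_value line_push characteristic_map_push push_vertex. Qed.

Lemma edge_value_push m n (f : {omorphism 'I_m.+1 -> 'I_n.+1}) (x : X n) j k :
  edge_value (simplex_map f x) j k = edge_value x (f j) (f k).
Proof. by rewrite /edge_value line_push !characteristic_map_push !push_vertex. Qed.

Variable P : R -> R.

(** If [P] is a primitive of a density, this is the integral of the density over the [j]-th interval
    of the partition given by [t]. *)
Definition weight n (t : stdsimplex R n) (j : 'I_n.+1) : R :=
  P (partial_bc t j.+1) - P (partial_bc t j).

Lemma initial_segment m n (f : 'I_m.+1 -> 'I_n.+1) k : {homo f : i j / (i <= j)%N} ->
  exists2 l, (l <= m.+1)%N & forall j, (f j < k)%N = (j < l)%N.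
Proof.
move=> fm; have [allk|] := pselect (forall j, (f j < k)%N).
  by exists m.+1 => // j; rewrite allk ltn_ord.
move=> /existsNP[j0 /negP]; rewrite -leqNgt => kj0.
case: (@arg_minnP _ j0 (fun j => k <= f j)%N (fun j => j : nat) kj0) => l kl lmin.
exists l; first by rewrite ltnW// ltnS ltnW.
move=> j; apply/idP/idP => [fjk|jl].
  rewrite ltnNge; apply/negP => lj; have := leq_trans kl (fm _ _ lj).
  by rewrite leqNgt fjk.
by rewrite ltnNge; apply/negP => /lmin; rewrite leqNgt jl.
Qed.

(** The fibres of a monotone map are runs of consecutive intervals, over which the weights
    telescope. *)
Lemma weight_push m n (f : 'I_m.+1 -> 'I_n.+1) (t : stdsimplex R m) k :
  {homo f : i j / (i <= j)%N} ->
  weight (push f t) k = \sum_(j | f j == k) weight t j.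
Proof.
move=> fm.
have S l : \sum_(j | (f j < l)%N) weight t j = P (partial_bc (push f t) l) - P 0.
  have [J Jm JE] := initial_segment l fm.
  rewrite (eq_bigl _ _ JE) partial_bc_push (eq_bigl _ _ JE) -/(partial_bc t J).
  rewrite -(big_ord_widen m.+1 (fun j => P (partial_bc t j.+1) - P (partial_bc t j)) Jm).
  rewrite -(big_mkord xpredT (fun j => P (partial_bc t j.+1) - P (partial_bc t j))).
  by rewrite telescope_sumr// partial_bc0.
have -> : weight (push f t) k =
    (P (partial_bc (push f t) k.+1) - P 0) - (P (partial_bc (push f t) k) - P 0).
  by rewrite /weight; ring.
rewrite -!S [X in X - _](bigID (fun j => f j == k))/=.
rewrite [X in _ + X - _](eq_bigl (fun j => (f j < k)%N)); last first.
  by move=> j; rewrite ltnS [in RHS]ltn_neqAle andbC.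
rewrite addrK; apply: eq_bigl => j.
by case: eqP => [->|_]; rewrite ?andbF// ltnSn.
Qed.

Definition sign_F2 (v : 'F_2) : R := if v == 0 then 1 else -1.

Lemma sign_F2D u v : sign_F2 (u + v) = sign_F2 u * sign_F2 v.
Proof.
rewrite /sign_F2; have [->|/neq0_F2 ->] := eqVneq u 0; first by rewrite add0r mul1r.
have [->|/neq0_F2 ->] := eqVneq v 0; first by rewrite addr0 mulr1 oner_eq0.
by rewrite addrr_F2 eqxx mulrNN mulr1.
Qed.

(* A section of the line bundle attached to a, in the trivialisation given at each
   point by the straight lines to the vertices of its cell. *)
Definition cell_section n (x : X n) (t : stdsimplex R n) : R :=
  \sum_j sign_F2 (vertex_value x t j) * weight t j.

Lemma cell_section_push m n (f : {omorphism 'I_m.+1 -> 'I_n.+1}) (x : X n) t :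
  cell_section (simplex_map f x) t = cell_section x (push f t).
Proof.
rewrite /cell_section (partition_big f xpredT)//=; apply: eq_bigr => k _.
rewrite weight_push; last exact: omorphism_homo.
by rewrite big_distrr/=; apply: eq_bigr => j /eqP <-; rewrite vertex_value_push.
Qed.

Definition bundle_section (p : RX) : R :=
  cell_section (cell_simplex (normal_form p)) (cell_point (normal_form p)).

Lemma cell_section_char m n (x : X m) t (y : X n) u :
  char x t = char y u -> cell_section x t = cell_section y u.
Proof.
by move=> /characteristic_mapP[q [f [g [v [fg <- <-]]]]]; rewrite -!cell_section_push fg.
Qed.

Lemma bundle_section_char n (x : X n) t : bundle_section (char x t) = cell_section x t.
Proof. exact: cell_section_char (normal_formK _). Qed.

Hypothesis cP : continuous P.

(** The section in the trivialisation by vertex 0. The remaining factor in [cell_sectionE] is a sign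
    that depends on arbitrary values of the cocycle and need not be continuous in [t]; this one is
    continuous and has the same zeros. *)
Definition reduced_section n (x : X n) (t : stdsimplex R n) : R :=
  \sum_j sign_F2 (edge_value x ord0 j) * weight t j.

Lemma cell_sectionE n (x : X n) t :
  cell_section x t = sign_F2 (vertex_value x t ord0) * reduced_section x t.
Proof.
rewrite big_distrr/=; apply: eq_bigr => j _.
by rewrite -(vertex_valueD x t) sign_F2D !mulrA -sign_F2D addrr_F2 /sign_F2 eqxx mul1r.
Qed.

Lemma partial_bc_continuous n k : continuous (fun t : stdsimplex R n => partial_bc t k).
Proof. by apply: cts_sum => i; exact: bc_continuous. Qed.

Lemma reduced_section_continuous n (x : X n) : continuous (reduced_section x).
Proof.
apply: cts_sum => j; apply: ctsM; first exact: cts_cst.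
by apply: ctsB; apply: cts_comp cP; exact: partial_bc_continuous.
Qed.

Lemma sign_F2_neq0 v : sign_F2 v != 0.
Proof. by rewrite /sign_F2; case: ifP; rewrite ?oppr_eq0 oner_eq0. Qed.

Lemma nonzero_section_open : open [set p | bundle_section p != 0].
Proof.
have -> : [set p | bundle_section p != 0] = ~` [set p | bundle_section p = 0].
  by apply/seteqP; split=> p /= /eqP.
apply: closed_openC; apply/closed_realizationP => n x.
have -> : char x @^-1` [set p | bundle_section p = 0] = reduced_section x @^-1` [set 0].
  apply/seteqP; split=> t /=; rewrite bundle_section_char cell_sectionE.
    by move/eqP; rewrite mulf_eq0 (negbTE (sign_F2_neq0 _)) => /eqP.
  by move=> ->; rewrite mulr0.
apply: closed_comp => [t _|]; last exact: closed_eq.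
exact: reduced_section_continuous.
Qed.

Definition negative (r : R) : 'F_2 := if r < 0 then 1 else 0.

Definition section_sign (p : RX) : 'F_2 := negative (bundle_section p).

Lemma section_sign_char n (x : X n) t : cell_section x t != 0 ->
  section_sign (char x t) = vertex_value x t ord0 + negative (reduced_section x t).
Proof.
rewrite /section_sign /negative bundle_section_char cell_sectionE /sign_F2.
have [->|/neq0_F2 ->] := eqVneq (vertex_value x t ord0) 0; first by rewrite mul1r add0r.
rewrite mulN1r oppr_eq0 oppr_lt0; by case: ltgtP => //= _ _; rewrite ?addr0 ?addrr_F2.
Qed.

(** The reduced section has no zero on the path, so its sign is constant by the intermediate value
    theorem. What remains is the transport from the two ends to vertex 0, given by
    [path_holonomy_line]. *)
Lemma section_sign_paths n (x : X n) (c : R -> stdsimplex R n) :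
  continuous c -> (forall r, bundle_section (char x (c r)) != 0) ->
  path_holonomy a (fun r => char x (c r)) 0 1 =
  section_sign (char x (c 0)) + section_sign (char x (c 1)).
Proof.
move=> cc nz; have {}nz r : cell_section x (c r) != 0 by rewrite -bundle_section_char.
rewrite !section_sign_char// (path_holonomy_line x (vertex R ord0) cc).
have cm : continuous (fun r => reduced_section x (c r)).
  exact: cts_comp cc (@reduced_section_continuous n x).
have mnz r : reduced_section x (c r) != 0.
  by apply: contraNneq (nz r) => mr; rewrite cell_sectionE mr mulr0.
have -> : negative (reduced_section x (c 1)) = negative (reduced_section x (c 0)).
  have [[r _ mr0]|] := pselect (exists2 r, `[0, 1]%classic r & reduced_section x (c r) = 0).
    by have := mnz r; rewrite mr0 eqxx.
  move=> nr; apply: contrapT => H; apply: nr.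
  have [||r r01 mr] := @IVT R (fun r => reduced_section x (c r)) 0 1 0 ler01.
  - exact: continuous_subspaceT.
  - move: H; have := mnz 0; have := mnz 1; rewrite ge_min le_max.
    by rewrite /negative; case: ltgtP => // ? _; case: ltgtP.
  - by exists r.
rewrite addrACA addrr_F2 addr0 /vertex_value addrACA addrr_F2 addr0.
by [].
Qed.

Theorem section_sign_singular (s : singular R RX 1) :
  (forall t, bundle_section (s t) != 0) ->
  a s = section_sign (s (vertex R ord0)) + section_sign (s (vertex R ord_max)).
Proof.
move=> sU; rewrite -ev_singular -path_holonomy_singular.
rewrite (small_paths az nonzero_section_open section_sign_paths).
- by rewrite /= interval_point0 interval_point1.
- exact: cts_comp (@interval_point_continuous R) (@cts_fun _ _ s).
- by move=> r; exact: sU.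
Qed.

End SignedSection.

(** * Counting faces *)

(** An entry is an edge, given by its two ends and the value of a cocycle on it; it is cut if the
    value corrected by [h] is nonzero. *)
Definition cut_by (V : Type) (h : V -> 'F_2) (e : V * V * 'F_2) : bool :=
  e.2 + h e.1.1 + h e.1.2 != 0.

(** Greedy choice, one vertex [u] at a time: the edges with exactly one end at [u] are decided by
    the value of [h] at [u], the others by induction. Loops are never cut, as their value is 0. *)
Lemma max_cut (V : eqType) (S : seq (V * V * 'F_2)) :
  (forall e, e \in S -> e.1.1 = e.1.2 -> e.2 = 0) ->
  exists h : V -> 'F_2, (2 * count (cut_by h) S <= size S)%N.
Proof.
have [k] := ubnP (size S); elim: k S => // k IH [|[[u v] c] S] /=.
  by exists (fun=> 0).
rewrite ltnS => Sk S0.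
have [uv|uv] := eqVneq u v.
  have [e eS|h hS] := IH S Sk; first by apply: S0; rewrite inE eS orbT.
  exists h => /=; have -> : c = 0 by apply: (S0 (u, v, c)); rewrite ?mem_head.
  by rewrite /cut_by/= uv add0r addrr_F2 eqxx add0n (leq_trans hS).
pose inc (e : V * V * 'F_2) := (e.1.1 == u) != (e.1.2 == u).
have incS : inc (u, v, c) by rewrite /inc/= eqxx [v == u]eq_sym (negbTE uv).
set S' := (u, v, c) :: S.
have [||h hS] := IH (seq.filter (predC inc) S').
- by rewrite size_filter /= incS (leq_ltn_trans (count_size _ _)).
- by move=> e; rewrite mem_filter => /andP[_]; exact: S0.
(* Changing [h] at [u] toggles exactly the edges in [inc], so [h] or [h1] cuts at most half of
   them. *)
pose h1 w := h w + (w == u)%:R.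
have split g : count (cut_by g) S' =
    (count (cut_by g) (seq.filter inc S') + count (cut_by g) (seq.filter (predC inc) S'))%N.
  by rewrite -count_cat; apply/esym/permP; rewrite perm_filterC.
have rest : count (cut_by h1) (seq.filter (predC inc) S') = count (cut_by h) (seq.filter (predC inc) S').
  apply: eq_in_count => e; rewrite mem_filter => /andP[/= /negbNE/eqP E _].
  rewrite /cut_by /h1 E !addrA (addrAC _ _ (h e.1.2)) -[X in _ = (X != 0)]addr0.
  by rewrite -(addrr_F2 ((e.1.2 == u)%:R)) !addrA.
have flip : (count (cut_by h1) (seq.filter inc S') + count (cut_by h) (seq.filter inc S'))%N =
    size (seq.filter inc S').
  rewrite -[RHS](count_predC (cut_by h)) addnC; congr (_ + _)%N.
  apply: eq_in_count => e; rewrite mem_filter => /andP[]; rewrite /inc /cut_by /h1 /= => E _.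
  have -> : e.2 + (h e.1.1 + (e.1.1 == u)%:R) + (h e.1.2 + (e.1.2 == u)%:R) =
      e.2 + h e.1.1 + h e.1.2 + ((e.1.1 == u)%:R + (e.1.2 == u)%:R) by ring.
  have -> : (e.1.1 == u)%:R + (e.1.2 == u)%:R = 1 :> 'F_2.
    by case: (e.1.1 == u) E; case: (e.1.2 == u) => //= _; rewrite ?addr0 ?add0r.
  have [->|/neq0_F2 ->] := eqVneq (e.2 + h e.1.1 + h e.1.2) 0.
    by rewrite add0r oner_eq0.
  by rewrite addrr_F2 eqxx.
have sizeS : (size (seq.filter inc S') + size (seq.filter (predC inc) S'))%N = size S'.
  by rewrite -size_cat; apply: perm_size; rewrite perm_filterC.
have := split h; have := split h1; rewrite rest.
have [le|lt] := leqP (count (cut_by h1) (seq.filter inc S')) (count (cut_by h) (seq.filter inc S')) => s1 s0.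
  exists h1; change (2 * count (cut_by h1) S' <= size S')%N; lia.
exists h; change (2 * count (cut_by h) S' <= size S')%N; lia.
Qed.

(** Each new function is chosen by [max_cut] for the elements that survive the previous ones, and
    halves their number. *)
Lemma iterated_max_cut (V T I : eqType) (u v : I -> T -> V) (c : I -> T -> 'F_2)
    (Y : seq T) (s : seq I) :
  (forall i y, y \in Y -> u i y = v i y -> c i y = 0) -> uniq s ->
  exists h : I -> V -> 'F_2,
    (2 ^ size s * count (fun y => all (fun i => cut_by (h i) (u i y, v i y, c i y)) s) Y
      <= size Y)%N.
Proof.
move=> Yc; elim: s => [|i s IH] /=.
  by exists (fun _ _ => 0); rewrite mul1n count_size.
move=> /andP[is_ us]; have [h hY] := IH us.
pose survives y := all (fun j => cut_by (h j) (u j y, v j y, c j y)) s.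
have [|h0 h0Z] := @max_cut V (map (fun y => (u i y, v i y, c i y)) (seq.filter survives Y)).
  by move=> e /mapP[y]; rewrite mem_filter => /andP[_ yY] -> /=; exact: Yc.
exists (fun j => if j == i then h0 else h j).
rewrite (@eq_count _ _ (predI (fun y => cut_by h0 (u i y, v i y, c i y)) survives)).
  rewrite -count_filter expnS -mulnA mulnCA; apply: leq_trans hY.
  rewrite leq_mul2l; apply/orP; right; rewrite -[leqRHS]size_filter.
  by move: h0Z; rewrite count_map size_map.
move=> y /=; rewrite eqxx; congr (_ && _); apply: eq_in_all => j js.
by case: eqP => // ji; rewrite -ji js in is_.
Qed.

(** An infinite set would contain a copy of the natural numbers. [{classic T}] supplies the equality
    used for membership in a list. *)
Lemma enumerate_small (T : Type) (A : set T) m : ~~ (`I_m #<= A)%card ->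
  exists s : seq {classic T}, (size s < m)%N /\ forall x, A x -> (x : {classic T}) \in s.
Proof.
move=> nA; have [/finite_setP[k Ak]|] := pselect (finite_set A); last first.
  move=> /infiniteP natA; case/negP: nA; apply: card_le_trans natA.
  exact: subset_card_le.
have km : (k < m)%N.
  rewrite ltnNge; apply: contra nA => mk; apply: card_le_trans (_ : `I_k #<= A)%card.
    by rewrite card_le_II.
  by move: Ak; rewrite card_eq_le => /andP[].
have /card_set_bijP[f [fA finj fsurj]] := Ak.
have /choice[g gP] : forall i : 'I_k, exists x, A x /\ f x = i.
  by move=> i; have [x Ax fx] := fsurj i (ltn_ord i); exists x.
exists (map g (enum 'I_k)); rewrite size_map size_enum_ord; split=> // x Ax.
apply/mapP; exists (Ordinal (fA _ Ax)); first by rewrite mem_enum.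
by have [Ag fg] := gP (Ordinal (fA _ Ax)); apply: finj; rewrite ?inE ?fg.
Qed.

(** * Cup products at the level of cocycles *)

Section CupProducts.
Variables (R : realType) (Y : topologicalType).

Fixpoint cup_cocycles n : ('I_n -> cocycle R 'F_2 Y 1) -> cocycle R 'F_2 Y n :=
  match n with
  | 0 => fun=> Cocycle (one_is_cocycle R 'F_2 Y)
  | m.+1 => fun A => cup_cocycle (A ord0) (cup_cocycles (fun i => A (lift ord0 i)))
  end.

Lemma cup_prod_pi n (A : 'I_n -> cocycle R 'F_2 Y 1) :
  cup_prod (fun i => \pi_(cohomology R 'F_2 Y 1) (A i)) =
  \pi_(cohomology R 'F_2 Y n) (cup_cocycles A).
Proof.
elim: n A => [//|n IH] A /=; rewrite IH; exact: (@pi_cup_class R 'F_2 Y 1 n).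
Qed.

Lemma cup_cocycles_eq0 n (A : 'I_n -> cocycle R 'F_2 Y 1) i (s : singular R Y n) :
  (forall f, cocycle_val (A i) (pullback s f) = 0) -> cocycle_val (cup_cocycles A) s = 0.
Proof.
move=> Ai; elim: n A i s Ai => [|n IH] A i s Ai; first by case: i Ai.
rewrite /= /cup; have [i0|] := unliftP ord0 i; last first.
  by move=> i0; rewrite i0 in Ai; rewrite Ai mul0r.
move=> ij; rewrite [X in _ * X](IH _ i0) ?mulr0// => f.
by rewrite pullback_comp -ij Ai.
Qed.

Lemma pi_cocycle_eq n (a b : cocycle R 'F_2 Y n) :
  exact_cochain (cocycle_val a - cocycle_val b) ->
  \pi_(cohomology R 'F_2 Y n) a = \pi_(cohomology R 'F_2 Y n) b.
Proof. by move=> ab; apply/eqP; rewrite -Quotient.idealrBE; apply/asboolP. Qed.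

Definition vertex_cochain (F : Y -> 'F_2) : cochain R 'F_2 Y 0 := fun s => F (s (vertex R ord0)).

Lemma coboundary_vertex (F : Y -> 'F_2) (s : singular R Y 1) :
  coboundary (vertex_cochain F) s = F (s (vertex R ord0)) + F (s (vertex R ord_max)).
Proof.
rewrite /coboundary !big_ord_recl big_ord0 addr0 !signr_F2 !mul1r /vertex_cochain/=.
rewrite !push_vertex addrC; congr (F (s (vertex R _)) + F (s (vertex R _))); exact/val_inj.
Qed.

Lemma coboundary_vertex_cocycle (F : Y -> 'F_2) :
  coboundary (vertex_cochain F) \in @is_cocycle R 'F_2 Y 1.
Proof.
apply/eqP/funext => s.
have -> : coboundary (coboundary (vertex_cochain F)) s =
    \sum_(i < 3) (F (s (vertex R (lift i ord0))) + F (s (vertex R (lift i ord_max)))).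
  by apply: eq_bigr => i _; rewrite signr_F2 mul1r coboundary_vertex/= !push_vertex.
rewrite !big_ord_recl big_ord0 addr0.
pose v0 := F (s (vertex R ord0)).
pose v1 := F (s (vertex R (lift ord0 ord0))); pose v2 := F (s (vertex R ord_max)).
transitivity (v1 + v2 + (v0 + v2 + (v0 + v1))).
  congr (F (s (vertex R _)) + F (s (vertex R _)) + (F (s (vertex R _)) +
    F (s (vertex R _)) + (F (s (vertex R _)) + F (s (vertex R _)))));
    exact/val_inj.
have -> : v1 + v2 + (v0 + v2 + (v0 + v1)) = (v1 + v1) + (v2 + v2) + (v0 + v0) by ring.
by rewrite !addrr_F2.
Qed.

End CupProducts.

(* The Lusternik-Schnirelmann argument for the cup-length. *)
Lemma cup_cocycles_exact (R : realType) (Y : topologicalType) n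
    (b : 'I_n -> cocycle R 'F_2 Y 1) (U : 'I_n -> set Y) :
  (forall i, open (U i)) -> (forall y, exists i, U i y) ->
  (forall i (s : singular R Y 1), (forall t, U i (s t)) -> cocycle_val (b i) s = 0) ->
  exact_cochain (cocycle_val (cup_cocycles b)).
Proof.
case: n b U => [|n] b U oU cU bU.
  (* For [n = 0] the cover has no members, so [Y] has no points and there are no singular
     simplices. *)
  by apply/funext => s; have [[]] := cU (s (vertex R ord0)).
apply: (@small_cocycle_exact R _ _ U) => //.
  by apply/eqP; exact: (cocycleP (cup_cocycles b)).
move=> s [i si]; apply: (cup_cocycles_eq0 (i := i)) => f; apply: bU => t.
exact: si.
Qed.

Section Loops.
Variables (R : realType) (X : simplicial_set).
Local Notation RX := (realization R X).
Local Notation char := (characteristic_map R).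

(** Used to replace a contraction, which is only continuous on a strip, by a map continuous on the
    whole plane. *)
Lemma within_continuous_into (S T Z : topologicalType) (A : set T) (H : T -> Z) (f : S -> T) :
  {within A, continuous H} -> continuous f -> (forall x, A (f x)) ->
  continuous (fun x => H (f x)).
Proof.
move=> cH cf fA x W HW.
have HW' : nbhs (f x) (fun y => A y -> W (H y)).
  have := cH (f x) W HW.
  by rewrite /nbhs/= -(nbhs_subspace_in (fA x)).
have C : nbhs x (fun y => A (f y) -> W (H (f y))) := cf x _ HW'.
change (nbhs x (fun y => W (H (f y)))); apply: filterS C => y; apply; exact: fA.
Qed.

(** The edge is a loop in the closed face. Contracting it gives a square whose far side is constant
    and whose lateral sides agree, hence cancel modulo two. *)
Lemma contractible_loop (a : cochain R 'F_2 RX 1) n (x : X n) j k :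
  coboundary a = 0 -> contractible R (closed_face R x) ->
  char x (vertex R j) = char x (vertex R k) ->
  line a x (vertex R j) (vertex R k) = 0.
Proof.
move=> az [c [H [cH H0 H1]]] jk.
have mem r : char x r \in closed_face R x by apply/mem_set; exists r.
pose l (r : R) : set_type (closed_face R x) :=
  exist (fun u => u \in closed_face R x) _ (mem (affine (pair_of (vertex R j) (vertex R k)) (interval_point r))).
have cl : continuous l.
  apply/continuous_comp_initial.
  exact: (cts_comp (cts_comp (@interval_point_continuous R) (@affine_continuous R 1 n _))
    (@characteristic_map_continuous R X n x)).
pose G (p : R * R) : RX := set_val (H (l p.1, clamp 0 1 p.2)).
have cG : continuous G.
  apply: (cts_comp (f := fun p : R * R => H (l p.1, clamp 0 1 p.2))); last first.
    exact: initial_continuous.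
  apply: (within_continuous_into (f := fun p : R * R => (l p.1, clamp 0 1 p.2)) cH).
    apply: cts_pair.
      by apply: cts_comp cl; apply: cts_fst; exact: cts_id.
    by apply: cts_comp (@clamp_continuous R 0 1); apply: cts_snd; exact: cts_id.
  by move=> p; split=> //=; rewrite in_itv/=; exact: clamp_itv.
have := square_holonomy 0 1 az cG.
have -> : (fun r => G (r, 1)) = fun=> set_val c.
  by apply/funext => r; rewrite /G/= clamp_id ?lexx ?ler01// H1.
have -> : (fun r => G (r, 0)) = (fun s => char x (affine (pair_of (vertex R j) (vertex R k)) s)) \o @interval_point R.
  by apply/funext => r; rewrite /G/= clamp_id ?lexx ?ler01// H0.
rewrite path_holonomy_singular path_holonomy_cst// add0r -/(line a x _ _) => ->.
have l01 : l 0 = l 1.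
  by apply: val_inj => /=; rewrite interval_point0 interval_point1 !affine_vertex.
have -> : (fun r => G (0, r)) = (fun r => G (1, r)) by apply/funext => r; rewrite /G/= l01.
exact: addrr_F2.
Qed.

End Loops.

Lemma monotone_collapse n m (f : 'I_n.+1 -> 'I_m.+1) :
  {homo f : i j / (i <= j)%N} -> (m < n)%N ->
  exists i : 'I_n, f (widen_ord (leqnSn n) i) = f (lift ord0 i).
Proof.
case: n f => // n f fm mn; apply: monotone_noninjective => // finj.
by have := leq_card f finj; rewrite !card_ord ltnS leqNgt mn.
Qed.

(** * Common zeros of the sections yield faces *)

Section ZeroSets.
Variables (R : realType) (X : simplicial_set) (n : nat).
Local Notation RX := (realization R X).
Local Notation char := (characteristic_map R).
Variable a : 'I_n -> cochain R 'F_2 RX 1.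
Hypothesis az : forall i, coboundary (a i) = 0.

(* The unit interval is cut into n blocks; [block i] measures the part of [0, r] that
   lies in the i-th one. *)
Definition block (i : nat) (r : R) : R := clamp 0 1 (n%:R * r - i%:R).

Lemma block_continuous i : continuous (block i).
Proof.
apply: cts_comp (@clamp_continuous R 0 1).
by apply: ctsB; [apply: ctsM; [exact: cts_cst|exact: cts_id]|exact: cts_cst].
Qed.

Lemma block_le i r s : r <= s -> block i r <= block i s.
Proof. by move=> rs; apply: clamp_le; rewrite lerD2r ler_wpM2l. Qed.

Lemma block0 i : block i 0 = 0.
Proof. by rewrite /block mulr0 sub0r clamp_lo// oppr_le0. Qed.

Lemma block1 i : (i < n)%N -> block i 1 = 1.
Proof.
move=> ilt; rewrite /block mulr1 clamp_hi ?ler01// lerBrDl natr1.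
by rewrite ler_nat.
Qed.

Lemma weight_block_ge0 i m (t : stdsimplex R m) j : 0 <= weight (block i) t j.
Proof. by rewrite subr_ge0 block_le// partial_bc_le. Qed.

Lemma weight_block_sum i m (t : stdsimplex R m) : (i < n)%N ->
  \sum_j weight (block i) t j = 1.
Proof. by move=> ilt; rewrite telescope_partial_bc block0 block1// subr0. Qed.

(** The point [(i + 1) / n] separates the two blocks: the [j]-th interval starts before it and the
    [k]-th one ends after it. *)
Lemma weight_block_order i m (t : stdsimplex R m) (j k : 'I_m.+1) :
  0 < weight (block i) t j -> 0 < weight (block i.+1) t k -> (j <= k)%N.
Proof.
rewrite !subr_gt0 => wj wk; rewrite -ltnS; apply: (partial_bc_lt (t := t)).
have jlt : n%:R * partial_bc t j < i%:R + 1.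
  rewrite ltNge; apply/negP => ij; move: wj; rewrite ltNge /block.
  by rewrite [X in _ <= X]clamp_hi ?ler01 ?lerBrDl//; case/andP: (clamp_itv (n%:R * partial_bc t j.+1 - i%:R) (@ler01 R)) => _ ->.
have klt : i%:R + 1 < n%:R * partial_bc t k.+1.
  rewrite ltNge; apply/negP => ij; move: wk; rewrite ltNge /block.
  rewrite [X in X <= _]clamp_lo -?natr1 ?subr_le0//.
  by case/andP: (clamp_itv (n%:R * partial_bc t k - (i%:R + 1)) (@ler01 R)) => ->.
have n0 : 0 < n%:R :> R.
  by rewrite lt_neqAle ler0n andbT; apply/eqP => n0; move: jlt klt; rewrite -n0 !mul0r; lra.
by rewrite -(ltr_pM2l n0) (lt_trans jlt).
Qed.

Variable h : 'I_n -> RX -> 'F_2.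
Local Notation section i := (bundle_section (a i) (h i) (block i)).
Local Notation edge i := (edge_value (a i) (h i)).

(** If all vertices of positive weight had the same sign, the section would be this sign times the
    total weight, which is 1. *)
Lemma zero_section_jump (i : 'I_n) m (x : X m) (t : stdsimplex R m) :
  section i (char x t) = 0 -> exists j k : 'I_m.+1,
    [/\ (j <= k)%N, edge i x j k = 1, 0 < weight (block i) t j & 0 < weight (block i) t k].
Proof.
rewrite bundle_section_char => s0.
suff [j [k [jk wj wk]]] : exists j k : 'I_m.+1,
    [/\ edge i x j k = 1, 0 < weight (block i) t j & 0 < weight (block i) t k].
  have [le|/ltnW le] := leqP j k; first by exists j, k.
  exists k, j; split=> //; rewrite -jk -!(vertex_valueD (az i) (h i) x t).
  exact: addrC.
have [j0 wj0] : exists j, 0 < weight (block i) t j.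
  apply: contrapT => /forallNP nw; have := weight_block_sum t (ltn_ord i).
  rewrite big1 => [/esym/eqP|j _]; first by rewrite oner_eq0.
  by apply/eqP; rewrite eq_le weight_block_ge0 andbT leNgt; apply/negP; exact: nw.
apply: contrapT => nj.
pose v := vertex_value (a i) (h i) x t.
have vE j : sign_F2 R (v j) * weight (block i) t j = sign_F2 R (v j0) * weight (block i) t j.
  have := weight_block_ge0 i t j; rewrite le_eqVlt => /predU1P[<-|wj].
    by rewrite !mulr0.
  congr (sign_F2 R _ * _).
  have [|/neq0_F2 e1] := eqVneq (edge i x j0 j) 0; last by case: nj; exists j0, j.
  by rewrite -(vertex_valueD (az i) (h i) x t) => /eqP; rewrite addr_eq0 oppr_F2 => /eqP.
move: s0; rewrite /cell_section (eq_bigr _ (fun j _ => vE j)) -big_distrr/=.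
by rewrite weight_block_sum// mulr1 => /eqP; rewrite (negbTE (sign_F2_neq0 _ _)).
Qed.

(* The vertices of the face are chosen greedily: since a_i jumps between lo i and hi i,
   it jumps between the i-th chosen vertex and one of them, which comes next. *)
Lemma common_zero_face (p : RX) : (forall i, section i p = 0) ->
  exists y : X n, faces X n y /\
    forall i : 'I_n, edge i y (widen_ord (leqnSn n) i) (lift ord0 i) = 1.
Proof.
have [m [x [t ->]]] := realization_cell p => s0.
have /choice[lo /choice[hi lohi]] := fun i => zero_section_jump (s0 i).
pose step (i : 'I_n) (w : 'I_m.+1) := if edge i x w (lo i) == 0 then hi i else lo i.
(* Only [v 0], ..., [v n] are used; past that range [insub] fails and the sequence is constant. *)
pose v := fix v (k : nat) : 'I_m.+1 := if k is k'.+1 then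
  (if insub k' is Some i then step i (v k') else v k') else ord0.
have vS (i : 'I_n) : v i.+1 = step i (v i) by rewrite /= valK.
(* The vertex chosen last is [lo] or [hi] of the previous index, hence has positive weight in the
   previous block. *)
have v_lo (i : 'I_n) : (v i <= lo i)%N.
  case: i => k kn; elim: k kn => [//|k IH] kn.
  have kn' : (k < n)%N by rewrite ltnW.
  rewrite [v _](vS (Ordinal kn')) /step.
  have [_ _ wl wh] := lohi (Ordinal kn').
  have [_ _ wl' _] := lohi (Ordinal kn).
  by case: ifP => _; [exact: weight_block_order wh wl'|exact: weight_block_order wl wl'].
have v_edge (i : 'I_n) : edge i x (v i) (v i.+1) = 1.
  have [_ e1 _ _] := lohi i.
  rewrite vS /step; have [e0|/neq0_F2 //] := eqVneq (edge i x (v i) (lo i)) 0.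
  by rewrite (edge_valueD (az i) _ x _ (lo i)) e0 add0r.
have v_le (i : 'I_n) : (v i <= v i.+1)%N.
  have [lh _ _ _] := lohi i.
  by rewrite vS /step; case: ifP => _; rewrite ?v_lo// (leq_trans (v_lo i)).
have v_homo : {homo (fun k : 'I_n.+1 => v k) : i j / (i <= j)%N}.
  move=> [i /= _] [j jn] /= ij; elim: j jn ij => [|j IH] jn.
    by rewrite leqn0 => /eqP ->.
  rewrite leq_eqVlt => /predU1P[->//|]; rewrite ltnS => ij.
  exact: leq_trans (IH (ltnW jn) ij) (v_le (@Ordinal n j jn)).
pose y := simplex_map (monotone_map v_homo) x.
have y_edge (i : 'I_n) : edge i y (widen_ord (leqnSn n) i) (lift ord0 i) = 1.
  by rewrite edge_value_push; exact: v_edge.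
(* If [y] were degenerate, two consecutive vertices would be identified, and the edge between them
   would have value 0 instead of 1. *)
exists y; split=> // -[k [g [z [kn gs yE]]]].
have [i gi] := monotone_collapse (@omorphism_homo _ _ g) kn.
by have := y_edge i; rewrite yE edge_value_push gi edge_valuexx.
Qed.

End ZeroSets.

(** * The lower bound on the number of faces *)

Local Open Scope card_scope.

Theorem corollary1p2 (R : realType) (X : simplicial_set) (n : nat)
    (closed_faces_contractible : forall (k : nat) (x : X k),
       faces X k x -> contractible R (closed_face R x))
    (xi : 'I_n -> cohomology R 'F_2 (realization R X) 1)
    (xi_neq0 : cup_prod xi != 0) :
  `I_(2 ^ n)%N #<= faces X n.
Proof.
apply: contraNT xi_neq0 => /enumerate_small[s [ssize sfaces]].
pose a i : cochain R 'F_2 (realization R X) 1 := cocycle_val (repr (xi i)).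
have az i : coboundary (a i) = 0 by apply/eqP; exact: (cocycleP (repr (xi i))).
(* The list [s] is only known to contain the faces, so the others are filtered out. *)
pose Y := [seq y <- s | `[< faces X n y >]].
(* Vertices are compared as points of the realization: equal ends make the edge a loop there, to
   which [contractible_loop] applies. *)
pose u (i : 'I_n) (y : {classic X n}) :=
  characteristic_map R (y : X n) (vertex R (widen_ord (leqnSn n) i)).
pose v (i : 'I_n) (y : {classic X n}) :=
  characteristic_map R (y : X n) (vertex R (lift ord0 i)).
pose c (i : 'I_n) (y : {classic X n}) :=
  line (a i) (y : X n) (vertex R (widen_ord (leqnSn n) i)) (vertex R (lift ord0 i)).
have [|h hY] := @iterated_max_cut _ _ _ u v c Y (enum 'I_n) _ (enum_uniq _).
  move=> i y; rewrite mem_filter => /andP[/asboolP yf _].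
  by apply: contractible_loop => //; exact: closed_faces_contractible.
have noface (y : X n) : faces X n y -> ~ forall i : 'I_n,
    edge_value (a i) (h i) y (widen_ord (leqnSn n) i) (lift ord0 i) = 1.
  move=> yf ye; have : (0 < count (fun y => all (fun i => cut_by (h i) (u i y, v i y, c i y))
      (enum 'I_n)) Y)%N.
    rewrite -has_count; apply/hasP; exists (y : {classic X n}).
      by rewrite mem_filter sfaces// andbT; apply/asboolP.
    apply/allP => i _; rewrite /cut_by/= -/(edge_value (a i) (h i) y _ _) ye.
    exact: oner_neq0.
  (* A positive count would give [2 ^ n <= size Y <= size s < 2 ^ n]. *)
  move: hY; rewrite size_enum_ord; case: count => // k; rewrite mulnS => hY _.
  have Ys : (size Y <= size s)%N by rewrite size_filter count_size.
  by have := leq_trans (leq_addr _ _) (leq_trans hY Ys); rewrite leqNgt ssize.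
pose sec (i : 'I_n) := bundle_section (a i) (h i) (@block R n i).
have cover p : exists i, sec i p != 0.
  apply: contrapT => /forallNP nz.
  have [i|y [yf ye]] := @common_zero_face R X n a az h p.
    by apply/eqP; rewrite -[_ == _]negbK; apply/negP; exact: nz.
  exact: noface yf ye.
pose F i := section_sign (a i) (h i) (@block R n i).
(* Subtracting the coboundary of the sign of the section preserves the class and makes the cocycle
   vanish on the paths where the section has no zero. *)
have bz i : a i - coboundary (vertex_cochain (F i)) \in
    @is_cocycle R 'F_2 (realization R X) 1.
  by apply: rpredB; [exact: (cocycleP (repr (xi i)))|exact: coboundary_vertex_cocycle].
pose b i := Cocycle (bz i).
have xiE : xi = fun i => \pi_(cohomology R 'F_2 (realization R X) 1) (b i).
  apply/funext => i; rewrite -[LHS]reprK; apply: pi_cocycle_eq => /=.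
  by exists (vertex_cochain (F i)); rewrite opprB addrC subrK.
have b0 i (t : singular R (realization R X) 1) :
    (forall r, sec i (t r) != 0) -> cocycle_val (b i) t = 0.
  move=> tsec; rewrite /= [LHS]/(a i t - coboundary (vertex_cochain (F i)) t).
  rewrite coboundary_vertex (section_sign_singular (az i) (h := h i) (P := @block R n i))//.
    exact: subrr.
  exact: block_continuous.
have az0 : exact_cochain (cocycle_val (cup_cocycles b) - cocycle_val (0 : cocycle R 'F_2 (realization R X) n)).
  rewrite subr0; apply: (cup_cocycles_exact (U := fun i => [set p | sec i p != 0])) => //.
  by move=> i; apply: nonzero_section_open; [exact: az|exact: block_continuous].
rewrite xiE cup_prod_pi (pi_cocycle_eq az0); apply/eqP.
exact: raddf0.
Qed.
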